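(* Let $(\mathcal D:L)$ be a pure right coring extension of $(\mathcal C:A)$ and let $\Sigma$ be an $L$-$\mathcal C$ bicomodule. (1) $\Sigma$ is a weak cleft bicomodule for the pure right coring extension $(\mathcal D:L)$ of $(\mathcal C:A)$ if and only if $\Sigma$ is a Galois $\mathcal C$-comodule and satisfies the weak normal basis property. (2) $\Sigma$ is a cleft bicomodule for the pure right coring extension $(\mathcal D:L)$ of $(\mathcal C:A)$ if and only if $\Sigma$ is a Galois $\mathcal C$-comodule and satisfies the normal basis property.
   Context: Corings. Fix a commutative ring $k$; all algebras are associative unital $k$-algebras. For an algebra $A$, an $A$-coring is an $A$-bimodule $\mathcal C$ with $A$-bilinear coassociative coproduct $\Delta_{\mathcal C}:\mathcal C\to\mathcal C\otimes_A\mathcal C$, $c\mapsto c^{(1)}\otimes_A c^{(2)}$, and $A$-bilinear counit $\epsilon_{\mathcal C}:\mathcal C\to A$. A right $\mathcal C$-comodule is a right $A$-module $M$ with a right $A$-linear coassociative counital coaction $M\to M\otimes_A\mathcal C$, $m\mapsto m^{[0]}\otimes_A m^{[1]}$. $\mathrm{Hom}^{\mathcal C}(-,-)$ denotes right $\mathcal C$-colinear maps. Pure coring extensions. Let $\mathcal D$ be an $L$-coring; its coproduct and right coactions are written with lower indices, $d\mapsto d_{(1)}\otimes_L d_{(2)}$, $m\mapsto m_{[0]}\otimes_L m_{[1]}$. $(\mathcal D:L)$ is a right extension of $(\mathcal C:A)$ if $\mathcal C$ is a $\mathcal C$-$\mathcal D$ bicomodule with left regular coaction $\Delta_{\mathcal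 C}$ and some right $\mathcal D$-coaction $\tau_{\mathcal C}:c\mapsto c_{[0]}\otimes_L c_{[1]}$ (so the right $L$-action and $\tau_{\mathcal C}$ are left $A$-linear, and $\Delta_{\mathcal C}$ is right $\mathcal D$-colinear, $\mathcal C\otimes_A\mathcal C$ having coaction $\mathcal C\otimes_A\tau_{\mathcal C}$). Every right $\mathcal C$-comodule $M$ is a right $L$-module via $ml=m^{[0]}\epsilon_{\mathcal C}(m^{[1]}l)$. The extension is pure if for every right $\mathcal C$-comodule $(M,\varrho)$ the equalizer $M\xrightarrow{\varrho}M\otimes_A\mathcal C\rightrightarrows M\otimes_A\mathcal C\otimes_A\mathcal C$ of $\varrho\otimes_A\mathcal C$ and $M\otimes_A\Delta_{\mathcal C}$ in $\mathcal M_L$ is preserved by $-\otimes_L\mathcal D\otimes_L\mathcal D$. In this case every right $\mathcal C$-comodule $M$ is a right $\mathcal D$-comodule via $\tau_M(m)=m^{[0]}\epsilon_{\mathcal C}({m^{[1]}}_{[0]})\otimes_L{m^{[1]}}_{[1]}$, and $\mathcal C$-colinear maps are $\mathcal D$-colinear. Bicomodules. An $L$-$\mathcal C$ bicomodule is a left $L$-module and right $\mathcal C$-comodule $\Sigma$ (an $L$-$A$ bimodule) with left $L$-linear $\mathcal C$-coaction. $T=\mathrm{End}^{\mathcal C}(\Sigma)$ is an algebra under composition and an $L$-ring via $l\mapsto(x\mapsto lx)$; $\Sigma^*=\mathrm{Hom}_A(\Sigma,A)$ is an $A$-$L$ bimodule via $(a\xi l)(x)=a\xi(lx)$. Put $$\widetilde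 Q=\{q\in{}_A\mathrm{Hom}_L(\mathcal C,\Sigma^* )\mid c^{(1)}q(c^{(2)})(x)=q(c)(x^{[0]})x^{[1]}\ \ \forall x\in\Sigma,\,c\in\mathcal C\}.$$ For $p\in{}_L\mathrm{Hom}^{\mathcal D}(\mathcal D,\Sigma)$ (left $L$-linear right $\mathcal D$-colinear maps) and $q\in\widetilde Q$ define $q\bullet p:\mathcal C\to\mathcal C$, $(q\bullet p)(c)=q(c_{[0]})\big(p(c_{[1]})^{[0]}\big)p(c_{[1]})^{[1]}$, and $p\lozenge q:\mathcal D\to T$, $(p\lozenge q)(d)=p(d)^{[0]}q(p(d)^{[1]})(-)$. Cleftness. $\Sigma$ is weak cleft for the extension if there exist $j\in{}_L\mathrm{Hom}^{\mathcal D}(\mathcal D,\Sigma)$ and $\tilde\jmath\in\widetilde Q$ with $\tilde\jmath\bullet j=\mathrm{id}_{\mathcal C}$. It is cleft if $j,\tilde\jmath$ can be chosen such that, in addition, $j\lozenge\tilde\jmath=\epsilon_{\mathcal D}(-)1_T$. Galois comodules. $\Sigma$ is a Galois $\mathcal C$-comodule if for every right $A$-module $N$ the map $\mathrm{can}_N:\mathrm{Hom}_A(\Sigma,N)\otimes_T\Sigma\to N\otimes_A\mathcal C$, $\phi\otimes_T x\mapsto\phi(x^{[0]})\otimes_A x^{[1]}$, is an isomorphism. Normal basis. $T$-$\mathcal D$ bicomodules are left $T$-modules and right $\mathcal D$-comodules with left $T$-linear coaction; $\Sigma$ is one via evaluation and $\tau_\Sigma$, and $T\otimes_L\mathcal D$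 is one via left multiplication and $T\otimes_L\Delta_{\mathcal D}$. $\Sigma$ satisfies the weak normal basis property if it is isomorphic to a direct summand of $T\otimes_L\mathcal D$ as a $T$-$\mathcal D$ bicomodule, and the normal basis property if it is isomorphic to $T\otimes_L\mathcal D$ as a $T$-$\mathcal D$ bicomodule. *)

(* Defs.v *)
From HB Require Import structures.
From mathcomp Require Import all_boot all_algebra.
From mathcomp Require Import boolp functions.

Set Implicit Arguments.
Unset Strict Implicit.
Unset Printing Implicit Defensive.

Import GRing.Theory.
Local Open Scope ring_scope.
Local Open Scope quotient_scope.

Reserved Notation "a *^l m" (at level 40, left associativity).
Reserved Notation "m *^r a" (at level 40, left associativity).
Reserved Notation "M ⊗ N" (at level 40, left associativity).
Reserved Notation "M ⊗c N" (at level 40, left associativity).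
Reserved Notation "m ⊗e n" (at level 40, left associativity).
Reserved Notation "f ⊗m g" (at level 40, left associativity).
Reserved Notation "\tsum_ ( x , y <- z ) E"
  (at level 41, x name, y name, z at level 50, E at level 41,
   format "\tsum_ ( x ,  y  <-  z )  E").

(* The tensor product of a right and a left module given by their action maps,
   as the quotient of the formal sums of pairs; lists (without signs) suffice
   because - (m ⊗ n) = (- m) ⊗ n. *)
Section Tensor.
Variables (R : Type) (M N : zmodType) (r : M -> R -> M) (l : R -> N -> N).

Inductive tensor_rel : seq (M * N) -> seq (M * N) -> Prop :=
| TensorRefl s : tensor_rel s s
| TensorSym s t : tensor_rel s t -> tensor_rel t s
| TensorTrans s t u : tensor_rel s t -> tensor_rel t u -> tensor_rel s u
| TensorCat s s' t t' :
    tensor_rel s s' -> tensor_rel t t' -> tensor_rel (s ++ t) (s' ++ t')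
| TensorC s t : tensor_rel (s ++ t) (t ++ s)
| Tensor0 n : tensor_rel [:: (0, n)] [::]
| TensorDl m m' n : tensor_rel [:: (m + m', n)] [:: (m, n); (m', n)]
| TensorDr m n n' : tensor_rel [:: (m, n + n')] [:: (m, n); (m, n')]
| TensorA m a n : tensor_rel [:: (r m a, n)] [:: (m, l a n)].

Definition tensor_relb : rel (seq (M * N)) := fun s t => `[< tensor_rel s t >].

Lemma tensor_relb_refl : reflexive tensor_relb.
Proof. by move=> s; apply/asboolP; apply: TensorRefl. Qed.

Lemma tensor_relb_sym : symmetric tensor_relb.
Proof. by move=> s t; apply/asboolP/asboolP; apply: TensorSym. Qed.

Lemma tensor_relb_trans : transitive tensor_relb.
Proof.
by move=> s t u /asboolP ts /asboolP su; apply/asboolP; apply: TensorTrans su.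
Qed.

Canonical tensor_equiv :=
  EquivRel tensor_relb tensor_relb_refl tensor_relb_sym tensor_relb_trans.

Definition tensor : Type := {eq_quot tensor_equiv}.
HB.instance Definition _ := Choice.on tensor.
HB.instance Definition _ : EqQuotient _ tensor_equiv tensor :=
  EqQuotient.on tensor.

Definition tcls (s : seq (M * N)) : tensor := \pi_tensor s.

Lemma tclsP s t : tcls s = tcls t <-> tensor_rel s t.
Proof.
by split=> [/eqmodP/asboolP //|H]; apply/eqmodP/asboolP.
Qed.

Lemma tcls_repr (z : tensor) : tcls (repr z) = z.
Proof. exact: reprK. Qed.

Lemma tcls_ind (P : tensor -> Prop) : (forall s, P (tcls s)) -> forall z, P z.
Proof. by move=> H z; rewrite -(tcls_repr z). Qed.

Definition tadd (x y : tensor) : tensor := tcls (repr x ++ repr y).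
Definition topp (x : tensor) : tensor :=
  tcls [seq (- p.1, p.2) | p <- repr x].

Lemma repr_tcls s : tensor_rel (repr (tcls s)) s.
Proof. by apply/tclsP; rewrite tcls_repr. Qed.

Lemma tadd_cls s t : tadd (tcls s) (tcls t) = tcls (s ++ t).
Proof. by apply/tclsP; apply: TensorCat; apply: repr_tcls. Qed.

Lemma tensor_rel_opp s :
  tensor_rel ([seq (- p.1, p.2) | p <- s] ++ s) [::].
Proof.
elim: s => [|[m n] s IH]; first exact: TensorRefl.
rewrite -cat1s map_cat -catA /=.
set s' := map _ s in IH *.
have H : tensor_rel ([:: (- m, n); (m, n)] ++ (s' ++ s)) [::].
  rewrite -[[::]]/([::] ++ [::] : seq (M * N)); apply: TensorCat => //.
  apply: TensorTrans (Tensor0 n).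
  by apply: TensorSym; rewrite -(addNr m); apply: TensorDl.
apply: TensorTrans H.
have H' : tensor_rel (s' ++ [:: (m, n)] ++ s) ([:: (m, n)] ++ s' ++ s).
  by rewrite !catA; apply: TensorCat (TensorC _ _) (TensorRefl _).
exact: (TensorCat (TensorRefl [:: (- m, n)]) H').
Qed.

Fact taddA : associative tadd.
Proof.
elim/tcls_ind=> s; elim/tcls_ind=> t; elim/tcls_ind=> u.
by rewrite !tadd_cls catA.
Qed.

Fact taddC : commutative tadd.
Proof.
elim/tcls_ind=> s; elim/tcls_ind=> t; rewrite !tadd_cls.
by apply/tclsP/TensorC.
Qed.

Fact tadd0 : left_id (tcls [::]) tadd.
Proof. by elim/tcls_ind=> s; rewrite tadd_cls. Qed.

Fact taddN : left_inverse (tcls [::]) topp tadd.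
Proof.
move=> x; rewrite -{2}(tcls_repr x) /topp tadd_cls; apply/tclsP.
exact: tensor_rel_opp.
Qed.

HB.instance Definition _ :=
  GRing.isZmodule.Build tensor taddA taddC tadd0 taddN.

Definition tpure (m : M) (n : N) : tensor := tcls [:: (m, n)].

Lemma tcls_cat s t : tcls (s ++ t) = tcls s + tcls t.
Proof. by rewrite -tadd_cls. Qed.

Lemma tclsE s : tcls s = \sum_(p <- s) tpure p.1 p.2.
Proof.
elim: s => [|[m n] s IH]; first by rewrite big_nil.
by rewrite big_cons -cat1s tcls_cat IH.
Qed.

Lemma tpureDl m m' n : tpure (m + m') n = tpure m n + tpure m' n.
Proof. by rewrite -tcls_cat; apply/tclsP/TensorDl. Qed.

Lemma tpureDr m n n' : tpure m (n + n') = tpure m n + tpure m n'.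
Proof. by rewrite -tcls_cat; apply/tclsP/TensorDr. Qed.

Lemma tpureA m a n : tpure (r m a) n = tpure m (l a n).
Proof. by apply/tclsP/TensorA. Qed.

Lemma tensor_ind (P : tensor -> Prop) :
  P 0 -> (forall x y, P x -> P y -> P (x + y)) ->
  (forall m n, P (tpure m n)) -> forall z, P z.
Proof.
move=> P0 PD Pp z; rewrite -(tcls_repr z) tclsE.
by elim: (repr z) => [|p s IH]; rewrite ?big_nil // big_cons; apply: PD.
Qed.

Section Lift.
Variables (G : zmodType) (f : M -> N -> G).

Record balanced : Prop := Balanced {
  balDl : forall m m' n, f (m + m') n = f m n + f m' n;
  balDr : forall m n n', f m (n + n') = f m n + f m n';
  balA : forall m a n, f (r m a) n = f m (l a n)
}.

(* The additive map sending m ⊗ n to f m n. It is independent of the chosen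
   representative, hence meaningful, only for a balanced map f. *)
Definition tlift (z : tensor) : G := \sum_(p <- repr z) f p.1 p.2.

Hypothesis fB : balanced.

Lemma bal0l n : f 0 n = 0.
Proof. by apply: (@addrI _ (f 0 n)); rewrite -(balDl fB) !addr0. Qed.

Lemma tensor_rel_lift s t : tensor_rel s t ->
  \sum_(p <- s) f p.1 p.2 = \sum_(p <- t) f p.1 p.2.
Proof.
elim=> {s t}.
- by [].
- by move=> s t _ ->.
- by move=> s t u _ -> _ ->.
- by move=> s s' t t' _ IH _ IH'; rewrite !big_cat /= IH IH'.
- by move=> s t; rewrite !big_cat /= addrC.
- by move=> n; rewrite big_seq1 big_nil bal0l.
- by move=> m m' n; rewrite big_seq1 big_cons big_seq1 /= (balDl fB).
- by move=> m n n'; rewrite big_seq1 big_cons big_seq1 /= (balDr fB).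
- by move=> m a n; rewrite !big_seq1 (balA fB).
Qed.

Lemma tlift_cls s : tlift (tcls s) = \sum_(p <- s) f p.1 p.2.
Proof. by apply/tensor_rel_lift/repr_tcls. Qed.

Lemma tliftE m n : tlift (tpure m n) = f m n.
Proof. by rewrite tlift_cls big_cons big_nil addr0. Qed.

Lemma tliftD x y : tlift (x + y) = tlift x + tlift y.
Proof.
by elim/tcls_ind: x => s; elim/tcls_ind: y => t;
  rewrite -tcls_cat !tlift_cls big_cat.
Qed.

Lemma tlift0 : tlift 0 = 0.
Proof. by apply: (@addrI _ (tlift 0)); rewrite -tliftD !addr0. Qed.

End Lift.

Lemma tensor_ext (G : zmodType) (f g : tensor -> G) :
  {morph f : x y / x + y} -> {morph g : x y / x + y} ->
  (forall m n, f (tpure m n) = g (tpure m n)) -> f =1 g.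
Proof.
move=> fD gD fg; elim/tensor_ind => [|x y IHx IHy|//].
  have h0 (h : tensor -> G) : {morph h : x y / x + y} -> h 0 = 0.
    by move=> hD; apply: (@addrI _ (h 0)); rewrite -hD !addr0.
  by rewrite !h0.
by rewrite fD gD IHx IHy.
Qed.

End Tensor.

Notation "\tsum_ ( x , y <- z ) E" := (tlift (fun x y => E) z) : ring_scope.

(* An algebra given by a central ring map k -> A: unlike in algType, the zero
   algebra is allowed, and it does occur, as the endomorphism ring of 0. *)
Record kalg (k : comPzRingType) := KAlg {
  kalg_ring :> pzRingType;
  kalg_in : {rmorphism k -> kalg_ring};
  kalg_central : forall c a, kalg_in c * a = a * kalg_in c
}.

Definition base_alg (k : comPzRingType) : kalg k :=
  @KAlg k k (idfun : {rmorphism k -> k}) (@mulrC k).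

(* Module structures are explicit action maps, since one abelian group will
   carry several left and several right actions at the same time. *)
Record bimod_axioms (k : comPzRingType) (A B : kalg k) (M : zmodType)
    (l : A -> M -> M) (r : M -> B -> M) : Prop := BimodAxioms {
  bimod_lDr : forall a x y, l a (x + y) = l a x + l a y;
  bimod_lDl : forall a b x, l (a + b) x = l a x + l b x;
  bimod_lA : forall a b x, l (a * b) x = l a (l b x);
  bimod_l1 : forall x, l 1 x = x;
  bimod_rDl : forall x y a, r (x + y) a = r x a + r y a;
  bimod_rDr : forall x a b, r x (a + b) = r x a + r x b;
  bimod_rA : forall x a b, r x (a * b) = r (r x a) b;
  bimod_r1 : forall x, r x 1 = x;
  bimod_lr : forall a x b, r (l a x) b = l a (r x b);
  bimod_k : forall c x, l (kalg_in A c) x = r x (kalg_in B c)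
}.

(* A right B-module is a (base_alg k)-B bimodule. *)
Record bimod (k : comPzRingType) (A B : kalg k) := Bimod {
  bcar :> zmodType;
  lact : A -> bcar -> bcar;
  ract : bcar -> B -> bcar;
  bimodP : bimod_axioms lact ract
}.

Notation "a *^l m" := (lact a m) : ring_scope.
Notation "m *^r a" := (ract m a) : ring_scope.

Section BimodTheory.
Variables (k : comPzRingType) (A B : kalg k) (M : bimod A B).
Implicit Types (x y : M) (a : A) (b : B).
Lemma lactDr a x y : a *^l (x + y) = a *^l x + a *^l y.
Proof. exact: bimod_lDr (bimodP M) _ _ _. Qed.
Lemma lactDl a a' x : (a + a') *^l x = a *^l x + a' *^l x.
Proof. exact: bimod_lDl (bimodP M) _ _ _. Qed.
Lemma lactA a a' x : (a * a') *^l x = a *^l (a' *^l x).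
Proof. exact: bimod_lA (bimodP M) _ _ _. Qed.
Lemma lact1 x : 1 *^l x = x.
Proof. exact: bimod_l1 (bimodP M) _. Qed.
Lemma ractDl x y b : (x + y) *^r b = x *^r b + y *^r b.
Proof. exact: bimod_rDl (bimodP M) _ _ _. Qed.
Lemma ractDr x b b' : x *^r (b + b') = x *^r b + x *^r b'.
Proof. exact: bimod_rDr (bimodP M) _ _ _. Qed.
Lemma ractA x b b' : x *^r (b * b') = x *^r b *^r b'.
Proof. exact: bimod_rA (bimodP M) _ _ _. Qed.
Lemma ract1 x : x *^r 1 = x.
Proof. exact: bimod_r1 (bimodP M) _. Qed.
Lemma lract a x b : (a *^l x) *^r b = a *^l (x *^r b).
Proof. exact: bimod_lr (bimodP M) _ _ _. Qed.
Lemma lract_k c x : kalg_in A c *^l x = x *^r kalg_in B c.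
Proof. exact: bimod_k (bimodP M) _ _. Qed.
End BimodTheory.

Section BimodMaps.
Variable k : comPzRingType.

Record is_rmap (A A' B : kalg k) (M : bimod A B) (N : bimod A' B) (f : M -> N) :
    Prop := IsRmap {
  rmapD : forall x y, f (x + y) = f x + f y;
  rmapr : forall x b, f (x *^r b) = f x *^r b
}.

Record is_lmap (A B B' : kalg k) (M : bimod A B) (N : bimod A B') (f : M -> N) :
    Prop := IsLmap {
  lmapD : forall x y, f (x + y) = f x + f y;
  lmapl : forall a x, f (a *^l x) = a *^l f x
}.

Definition is_bimap (A B : kalg k) (M N : bimod A B) (f : M -> N) : Prop :=
  is_lmap f /\ is_rmap f.

End BimodMaps.

Program Definition reg_bimod (k : comPzRingType) (A : kalg k) : bimod A A :=
  @Bimod k A A A (fun a x => a * x) (fun x a => x * a) _.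
Next Obligation.
split=> *; rewrite ?mulrDl ?mulrDr ?mulrA ?mul1r ?mulr1 //.
exact: kalg_central.
Qed.

Section TensorBimod.
Variable k : comPzRingType.

Definition tens_car (A B C : kalg k) (M : bimod A B) (N : bimod B C) : zmodType :=
  tensor (@ract _ _ _ M) (@lact _ _ _ N).

Definition tens_elt (A B C : kalg k) (M : bimod A B) (N : bimod B C)
  (m : M) (n : N) : tens_car M N := tpure _ _ m n.

End TensorBimod.

Notation "m ⊗e n" := (tens_elt m n) : ring_scope.

Section TensorMap.
Variable k : comPzRingType.

Definition tmap (A A' B C C' : kalg k) (M : bimod A B) (M' : bimod A' B)
    (N : bimod B C) (N' : bimod B C') (f : M -> M') (g : N -> N') :
    tens_car M N -> tens_car M' N' :=
  fun z => \tsum_(m, n <- z) (f m ⊗e g n).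

Section Facts.
Variables (A A' B C C' : kalg k) (M : bimod A B) (M' : bimod A' B).
Variables (N : bimod B C) (N' : bimod B C') (f : M -> M') (g : N -> N').
Hypotheses (fM : is_rmap f) (gM : is_lmap g).

Lemma tmap_balanced :
  balanced (@ract _ _ _ M) (@lact _ _ _ N) (fun m n => f m ⊗e g n).
Proof.
split=> *; rewrite ?(rmapD fM) ?(lmapD gM) ?(rmapr fM) ?(lmapl gM).
- exact: tpureDl.
- exact: tpureDr.
- exact: tpureA.
Qed.

Lemma tmapE m n : tmap f g (m ⊗e n) = f m ⊗e g n.
Proof. exact: tliftE tmap_balanced _ _. Qed.

Lemma tmapD x y : tmap f g (x + y) = tmap f g x + tmap f g y.
Proof. exact: tliftD tmap_balanced _ _. Qed.
End Facts.

Lemma is_rmap_id (A B : kalg k) (M : bimod A B) : is_rmap (@id M).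
Proof. by []. Qed.

Lemma is_lmap_id (A B : kalg k) (M : bimod A B) : is_lmap (@id M).
Proof. by []. Qed.

Lemma is_rmap_l (A B : kalg k) (M : bimod A B) a : is_rmap (@lact _ _ _ M a).
Proof. by split=> *; rewrite ?lactDr ?lract. Qed.

Lemma is_lmap_r (A B : kalg k) (M : bimod A B) b :
  is_lmap (fun m : M => m *^r b).
Proof. by split=> *; rewrite ?ractDl ?lract. Qed.

Lemma tens_eltDl (A B C : kalg k) (M : bimod A B) (N : bimod B C) m m' n :
  (m + m') ⊗e n = m ⊗e n + m' ⊗e n :> tens_car M N.
Proof. exact: tpureDl. Qed.
Lemma tens_eltDr (A B C : kalg k) (M : bimod A B) (N : bimod B C) m n n' :
  m ⊗e (n + n') = m ⊗e n + m ⊗e n' :> tens_car M N.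
Proof. exact: tpureDr. Qed.
Lemma tens_eltA (A B C : kalg k) (M : bimod A B) (N : bimod B C) m b n :
  (m *^r b) ⊗e n = m ⊗e (b *^l n) :> tens_car M N.
Proof. exact: tpureA. Qed.

Lemma tens_ext (A B C : kalg k) (M : bimod A B) (N : bimod B C)
  (G : zmodType) (f g : tens_car M N -> G) :
  {morph f : x y / x + y} -> {morph g : x y / x + y} ->
  (forall m n, f (m ⊗e n) = g (m ⊗e n)) -> f =1 g.
Proof. exact: tensor_ext. Qed.

Section Bimod.
Variables (A B C : kalg k) (M : bimod A B) (N : bimod B C).

Definition tens_l (a : A) : tens_car M N -> tens_car M N :=
  tmap (fun m => a *^l m) id.
Definition tens_r (z : tens_car M N) (c : C) : tens_car M N :=
  tmap id (fun n => n *^r c) z.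

Lemma tens_lE a m n : tens_l a (m ⊗e n) = (a *^l m) ⊗e n.
Proof. by rewrite /tens_l tmapE //; apply: is_rmap_l. Qed.
Lemma tens_rE m n c : tens_r (m ⊗e n) c = m ⊗e (n *^r c).
Proof. by rewrite /tens_r tmapE //; apply: is_lmap_r. Qed.
Lemma tens_lD a x y : tens_l a (x + y) = tens_l a x + tens_l a y.
Proof. by rewrite /tens_l tmapD //; apply: is_rmap_l. Qed.
Lemma tens_rD x y c : tens_r (x + y) c = tens_r x c + tens_r y c.
Proof. by rewrite /tens_r tmapD //; apply: is_lmap_r. Qed.

Lemma tens_axioms : bimod_axioms tens_l tens_r.
Proof.
split.
- exact: tens_lD.
- move=> a b; apply: tens_ext => [x y|x y|m n].
  + exact: tens_lD.
  + by rewrite !tens_lD addrACA.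
  + by rewrite !tens_lE lactDl tens_eltDl.
- move=> a b; apply: tens_ext => [x y|x y|m n].
  + exact: tens_lD.
  + by rewrite !tens_lD.
  + by rewrite !tens_lE lactA.
- by apply: tens_ext => [x y|//|m n]; rewrite ?tens_lD ?tens_lE ?lact1.
- exact: tens_rD.
- move=> x a b; move: x; apply: tens_ext => [x y|x y|m n].
  + exact: tens_rD.
  + by rewrite !tens_rD addrACA.
  + by rewrite !tens_rE ractDr tens_eltDr.
- move=> x a b; move: x; apply: tens_ext => [x y|x y|m n].
  + exact: tens_rD.
  + by rewrite !tens_rD.
  + by rewrite !tens_rE ractA.
- by apply: (@tens_ext _ _ _ _ _ _ (tens_r^~ 1) id) => [x y|//|m n] /=;
    rewrite ?tens_rD ?tens_rE ?ract1.
- move=> a x b; move: x; apply: tens_ext => [x y|x y|m n].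
  + by rewrite tens_lD tens_rD.
  + by rewrite tens_rD tens_lD.
  + by rewrite !(tens_lE, tens_rE).
- move=> c x; move: x; apply: tens_ext => [x y|x y|m n].
  + exact: tens_lD.
  + exact: tens_rD.
  + by rewrite tens_lE tens_rE lract_k tens_eltA lract_k.
Qed.

Canonical tens : bimod A C := @Bimod k A C (tens_car M N) tens_l tens_r tens_axioms.

End Bimod.
End TensorMap.

Notation "M ⊗ N" := (tens M N) : type_scope.
Notation "f ⊗m g" := (tmap f g) : ring_scope.

#[global] Hint Resolve is_rmap_id is_lmap_id : core.

Section TensorMapTheory.
Variable k : comPzRingType.

Lemma is_rmap_tmap (A A' B C : kalg k) (M : bimod A B) (M' : bimod A' B)
    (N N' : bimod B C) (f : M -> M') (g : N -> N') :
  is_rmap f -> is_bimap g -> is_rmap (M := M ⊗ N) (N := M' ⊗ N') (f ⊗m g).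
Proof.
move=> fM [gl gr]; split=> [x y|x b]; first exact: tmapD.
move: x; apply: tens_ext => [x y|x y|m n] /=.
- by rewrite tens_rD tmapD.
- by rewrite tmapD // tens_rD.
- by rewrite tens_rE !tmapE // tens_rE (rmapr gr).
Qed.

Lemma is_lmap_tmap (A B C C' : kalg k) (M M' : bimod A B)
    (N : bimod B C) (N' : bimod B C') (f : M -> M') (g : N -> N') :
  is_bimap f -> is_lmap g -> is_lmap (M := M ⊗ N) (N := M' ⊗ N') (f ⊗m g).
Proof.
move=> [fl fr] gM; split=> [x y|b x]; first exact: tmapD.
move: x; apply: tens_ext => [x y|x y|m n] /=.
- by rewrite tens_lD tmapD.
- by rewrite tmapD // tens_lD.
- by rewrite tens_lE !tmapE // tens_lE (lmapl fl).
Qed.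

Lemma tmap_comp (A A' A'' B C C' C'' : kalg k) (M : bimod A B) (M' : bimod A' B)
    (M'' : bimod A'' B) (N : bimod B C) (N' : bimod B C') (N'' : bimod B C'')
    (f : M -> M') (f' : M' -> M'') (g : N -> N') (g' : N' -> N'') z :
  is_rmap f -> is_rmap f' -> is_lmap g -> is_lmap g' ->
  (f' ⊗m g') ((f ⊗m g) z) = ((f' \o f) ⊗m (g' \o g)) z.
Proof.
move=> fM f'M gM g'M.
have ffM : is_rmap (f' \o f).
  by split=> *; rewrite /= ?(rmapD fM, rmapr fM) ?(rmapD f'M, rmapr f'M).
have ggM : is_lmap (g' \o g).
  by split=> *; rewrite /= ?(lmapD gM, lmapl gM) ?(lmapD g'M, lmapl g'M).
by move: z; apply: tens_ext => [x y|x y|m n]; rewrite ?tmapD ?tmapE.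
Qed.

Lemma tens_elt_lmap (A B C : kalg k) (M : bimod A B) (N : bimod B C) n :
  is_lmap (B := B) (B' := C) (N := M ⊗ N) (fun m : M => m ⊗e n).
Proof. by split=> *; rewrite ?tens_eltDl //= tens_lE. Qed.

Lemma tens_elt_rmap (A B C : kalg k) (M : bimod A B) (N : bimod B C) m :
  is_rmap (A := B) (A' := A) (N := M ⊗ N) (fun n : N => m ⊗e n).
Proof. by split=> *; rewrite ?tens_eltDr //= tens_rE. Qed.

Section Assoc.
Variables (A B C E : kalg k).
Variables (M : bimod A B) (N : bimod B C) (P : bimod C E).

Definition tassoc (z : (M ⊗ N) ⊗ P) : M ⊗ (N ⊗ P) :=
  \tsum_(x, p <- z) \tsum_(m, n <- x) (m ⊗e (n ⊗e p)).

Definition tassocV (z : M ⊗ (N ⊗ P)) : (M ⊗ N) ⊗ P :=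
  \tsum_(m, x <- z) \tsum_(n, p <- x) ((m ⊗e n) ⊗e p).

Let bal1 (p : P) : balanced (@ract _ _ _ M) (@lact _ _ _ N)
  (fun m n => m ⊗e (n ⊗e p) : M ⊗ (N ⊗ P)).
Proof.
split=> *; rewrite ?tens_eltDl ?tens_eltDr ?tens_eltA //.
by congr (_ ⊗e _); rewrite /= tens_lE.
Qed.

Let bal2 : balanced (@ract _ _ _ (M ⊗ N)) (@lact _ _ _ P)
  (fun x p => \tsum_(m, n <- x) (m ⊗e (n ⊗e p)) : M ⊗ (N ⊗ P)).
Proof.
split=> [x y p|x p q|x c p] /=.
- exact: tliftD (bal1 p) _ _.
- move: x; apply: tens_ext => [x y|x y|m n].
  + exact: tliftD (bal1 _) _ _.
  + by rewrite !(tliftD (bal1 _)) addrACA.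
  + by rewrite !(tliftE (bal1 _)) !tens_eltDr.
- move: x; apply: tens_ext => [x y|x y|m n].
  + by rewrite tens_rD; apply: tliftD (bal1 _) _ _.
  + exact: tliftD (bal1 _) _ _.
  + by rewrite tens_rE !(tliftE (bal1 _)) tens_eltA.
Qed.

Let bal1V (m : M) : balanced (@ract _ _ _ N) (@lact _ _ _ P)
  (fun n p => (m ⊗e n) ⊗e p : (M ⊗ N) ⊗ P).
Proof.
split=> *; rewrite -?tens_eltA ?tens_eltDr ?tens_eltDl //.
by congr (_ ⊗e _); rewrite /= tens_rE.
Qed.

Let bal2V : balanced (@ract _ _ _ M) (@lact _ _ _ (N ⊗ P))
  (fun m x => \tsum_(n, p <- x) ((m ⊗e n) ⊗e p) : (M ⊗ N) ⊗ P).
Proof.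
split=> [m m' x|m x y|m c x] /=.
- move: x; apply: tens_ext => [x y|x y|n p].
  + exact: tliftD (bal1V _) _ _.
  + by rewrite !(tliftD (bal1V _)) addrACA.
  + by rewrite !(tliftE (bal1V _)) !tens_eltDl.
- exact: tliftD (bal1V m) _ _.
- move: x; apply: tens_ext => [x y|x y|n p].
  + exact: tliftD (bal1V _) _ _.
  + by rewrite tens_lD; apply: tliftD (bal1V _) _ _.
  + by rewrite tens_lE !(tliftE (bal1V _)) tens_eltA.
Qed.

Lemma tassocE m n p : tassoc ((m ⊗e n : M ⊗ N) ⊗e p) = m ⊗e (n ⊗e p : N ⊗ P).
Proof. by rewrite /tassoc (tliftE bal2) (tliftE (bal1 p)). Qed.
Lemma tassocD x y : tassoc (x + y) = tassoc x + tassoc y.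
Proof. exact: tliftD bal2 _ _. Qed.
Lemma tassocVE m n p : tassocV (m ⊗e (n ⊗e p : N ⊗ P)) = (m ⊗e n : M ⊗ N) ⊗e p.
Proof. by rewrite /tassocV (tliftE bal2V) (tliftE (bal1V m)). Qed.
Lemma tassocVD x y : tassocV (x + y) = tassocV x + tassocV y.
Proof. exact: tliftD bal2V _ _. Qed.

Lemma tens_ext3 (G : zmodType) (f g : (M ⊗ N) ⊗ P -> G) :
  {morph f : x y / x + y} -> {morph g : x y / x + y} ->
  (forall m n p, f ((m ⊗e n : M ⊗ N) ⊗e p) = g ((m ⊗e n : M ⊗ N) ⊗e p)) ->
  f =1 g.
Proof.
move=> fD gD fg; apply: tens_ext => // x p; move: x.
by apply: tens_ext => [x y|x y|//] /=; rewrite tens_eltDl ?fD ?gD.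
Qed.

Lemma tens_ext3V (G : zmodType) (f g : M ⊗ (N ⊗ P) -> G) :
  {morph f : x y / x + y} -> {morph g : x y / x + y} ->
  (forall m n p, f (m ⊗e (n ⊗e p : N ⊗ P)) = g (m ⊗e (n ⊗e p : N ⊗ P))) ->
  f =1 g.
Proof.
move=> fD gD fg; apply: tens_ext => // m x; move: x.
by apply: tens_ext => [x y|x y|//] /=; rewrite tens_eltDr ?fD ?gD.
Qed.

Lemma tassocK : cancel tassoc tassocV.
Proof.
by apply: (@tens_ext3 _ (tassocV \o tassoc) id) => [x y|//|m n p] /=;
  rewrite ?tassocD ?tassocVD ?tassocE ?tassocVE.
Qed.

Lemma tassocVK : cancel tassocV tassoc.
Proof.
by apply: (@tens_ext3V _ (tassoc \o tassocV) id) => [x y|//|m n p] /=;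
  rewrite ?tassocVD ?tassocD ?tassocVE ?tassocE.
Qed.

Lemma tassocV_bimap :
  is_bimap (M := M ⊗ (N ⊗ P)) (N := (M ⊗ N) ⊗ P) tassocV.
Proof.
split; split; try exact: tassocVD.
- move=> a; apply: tens_ext3V => [x y|x y|m n p] /=.
  + by rewrite tens_lD tassocVD.
  + by rewrite tassocVD tens_lD.
  + by rewrite tens_lE !tassocVE tens_lE; congr (_ ⊗e _); rewrite /= tens_lE.
- move=> x b; move: x; apply: tens_ext3V => [x y|x y|m n p] /=.
  + by rewrite tens_rD tassocVD.
  + by rewrite tassocVD tens_rD.
  + rewrite tens_rE tassocVE tens_rE /= -tassocVE; congr (tassocV (_ ⊗e _)).
    by rewrite /= tens_rE.
Qed.

End Assoc.
End TensorMapTheory.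

Section Coring.
Variables (k : comPzRingType) (A : kalg k).

Record coring_axioms (C : bimod A A) (cop : C -> C ⊗ C) (cou : C -> A) : Prop :=
  CoringAxioms {
  cop_bimap : is_bimap cop;
  cou_bimap : is_bimap (N := reg_bimod A) cou;
  cop_coassoc : forall c, tassoc ((cop ⊗m id) (cop c)) = (id ⊗m cop) (cop c);
  cop_coul : forall c, \tsum_(c1, c2 <- cop c) (cou c1 *^l c2) = c;
  cop_cour : forall c, \tsum_(c1, c2 <- cop c) (c1 *^r cou c2) = c
}.

Record coring := Coring {
  cor_bm :> bimod A A;
  cop : cor_bm -> cor_bm ⊗ cor_bm;
  cou : cor_bm -> A;
  corP : coring_axioms cop cou
}.

Record bicom_axioms (C : coring) (B : kalg k) (M : bimod B A)
    (rho : M -> M ⊗ C) : Prop := BicomAxioms {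
  coact_bimap : is_bimap rho;
  coact_coassoc : forall m,
    tassoc ((rho ⊗m id) (rho m)) = (id ⊗m (@cop C)) (rho m);
  coact_cou : forall m, \tsum_(m0, m1 <- rho m) (m0 *^r cou m1) = m
}.

(* B-C bicomodules; right C-comodules are the case B = base_alg k. *)
Record bicom (B : kalg k) (C : coring) := Bicom {
  bc_bm :> bimod B A;
  coact : bc_bm -> bc_bm ⊗ C;
  bicomP : bicom_axioms coact
}.

Record is_rcomap (B B' : kalg k) (C : coring) (M : bicom B C) (N : bicom B' C)
    (f : M -> N) : Prop := IsRcomap {
  rcomap_rmap : is_rmap f;
  rcomapE : forall m, coact (f m) = (f ⊗m id) (coact m)
}.

Definition is_comap (B : kalg k) (C : coring) (M N : bicom B C) (f : M -> N) :
    Prop :=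
  is_lmap f /\ is_rcomap f.

End Coring.

Section CounitMap.
Variables (k : comPzRingType) (A B : kalg k) (C : coring A) (M : bimod B A).

Definition ru (z : M ⊗ C) : M := \tsum_(m, c <- z) (m *^r cou c).

Let rl : is_lmap (N := reg_bimod A) (@cou _ _ C).
Proof. by case: (cou_bimap (corP C)). Qed.
Let rr : is_rmap (N := reg_bimod A) (@cou _ _ C).
Proof. by case: (cou_bimap (corP C)). Qed.

Let ruB : balanced (@ract _ _ _ M) (@lact _ _ _ C) (fun m c => m *^r cou c).
Proof.
split=> *; rewrite ?ractDl ?(lmapD rl) ?ractDr ?(lmapl rl) //=.
by rewrite ractA.
Qed.

Lemma ruE m c : ru (m ⊗e c) = m *^r cou c.
Proof. exact: tliftE ruB _ _. Qed.
Lemma ruD x y : ru (x + y) = ru x + ru y.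
Proof. exact: tliftD ruB _ _. Qed.
Lemma ru_bimap : is_bimap (M := M ⊗ C) ru.
Proof.
split; split; try exact: ruD.
- move=> a; apply: tens_ext => [x y|x y|m c] /=.
  + by rewrite tens_lD ruD.
  + by rewrite ruD lactDr.
  + by rewrite tens_lE !ruE lract.
- move=> x a; move: x; apply: tens_ext => [x y|x y|m c] /=.
  + by rewrite tens_rD ruD.
  + by rewrite ruD ractDl.
  + by rewrite tens_rE !ruE (rmapr rr) /= ractA.
Qed.
End CounitMap.

Section TensBicom.
Variables (k : comPzRingType) (A : kalg k) (C : coring A).

Program Definition reg_bicom : bicom A C := @Bicom k A A C C (@cop k A C) _.
Next Obligation. by case: (corP C) => *; split. Qed.

Variables (B R : kalg k) (M : bimod B R) (N : bicom R C).

(* The coaction M ⊗ rho_N. *)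
Definition tens_coact (z : M ⊗ N) : (M ⊗ N) ⊗ C :=
  tassocV ((id ⊗m (@coact _ _ _ _ N)) z).

Let rhoN : is_bimap (@coact _ _ _ _ N). Proof. exact: coact_bimap (bicomP N). Qed.
Let rhol : is_lmap (@coact _ _ _ _ N). Proof. by case: rhoN. Qed.
Let rhor : is_rmap (@coact _ _ _ _ N). Proof. by case: rhoN. Qed.

Lemma tens_coactD x y : tens_coact (x + y) = tens_coact x + tens_coact y.
Proof. by rewrite /tens_coact tmapD // tassocVD. Qed.

Lemma tens_coactE m n : tens_coact (m ⊗e n) = tassocV (m ⊗e coact n).
Proof. by rewrite /tens_coact tmapE. Qed.

Lemma tens_coact_bimap : is_bimap (M := M ⊗ N) tens_coact.
Proof.
have [tl tr] := tassocV_bimap M N C.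
have hl : is_lmap (M := M ⊗ N) (N := M ⊗ (N ⊗ C))
   (id ⊗m (@coact _ _ _ _ N)) by apply: is_lmap_tmap.
have hr : is_rmap (M := M ⊗ N) (N := M ⊗ (N ⊗ C))
   (id ⊗m (@coact _ _ _ _ N)) by apply: is_rmap_tmap.
split; split; try exact: tens_coactD; move=> *; rewrite /tens_coact.
- by rewrite (lmapl hl) (lmapl tl).
- by rewrite (rmapr hr) (rmapr tr).
Qed.

Lemma tens_bicom_axioms : bicom_axioms (M := M ⊗ N) tens_coact.
Proof.
have [tcl tcr] := tens_coact_bimap.
have cb : is_bimap (@cop _ _ C) := cop_bimap (corP C).
have cl : is_lmap (@cop _ _ C) by case: cb.
split; first exact: tens_coact_bimap.
- apply: tens_ext => [x y|x y|m n].
  + by rewrite tens_coactD tmapD // tassocD.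
  + by rewrite tens_coactD tmapD.
  rewrite tens_coactE.
  pose K (z : N ⊗ (C ⊗ C)) : (M ⊗ N) ⊗ (C ⊗ C) := tassocV (m ⊗e z).
  have KD x y : K (x + y) = K x + K y by rewrite /K tens_eltDr tassocVD.
  have -> : (id ⊗m (@cop _ _ C)) (tassocV (m ⊗e coact n)) =
            K ((id ⊗m (@cop _ _ C)) (coact n)).
    move: (coact n); apply: tens_ext => [x y|x y|n0 c].
    + by rewrite tens_eltDr tassocVD tmapD.
    + by rewrite tmapD // KD.
    + by rewrite tassocVE !tmapE // /K tassocVE.
  rewrite -(coact_coassoc (bicomP N)).
  move: (coact n); apply: tens_ext => [x y|x y|n0 c].
  + by rewrite tens_eltDr tassocVD tmapD // tassocD.
  + by rewrite tmapD // tassocD KD.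
  rewrite tassocVE !tmapE // tens_coactE.
  move: (coact n0); apply: tens_ext => [x y|x y|n1 c1].
  + by rewrite tens_eltDr tassocVD tens_eltDl tassocD.
  + by rewrite tens_eltDl tassocD KD.
  + by rewrite tassocVE !tassocE /K tassocVE.
- apply: (@tens_ext _ _ _ _ _ _ _ (@ru _ _ _ _ _ \o tens_coact) id)
    => [x y|//|m n] /=; first by rewrite tens_coactD ruD.
  rewrite tens_coactE.
  transitivity (m ⊗e (ru (coact n)) : M ⊗ N); last first.
    by congr (_ ⊗e _); apply: coact_cou (bicomP N) _.
  move: (coact n); apply: tens_ext => [x y|x y|n0 c].
  + by rewrite tens_eltDr tassocVD ruD.
  + by rewrite ruD tens_eltDr.
  + by rewrite tassocVE !ruE /= tens_rE.
Qed.

Definition tens_bicom : bicom B C := Bicom tens_bicom_axioms.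

End TensBicom.

Notation "M ⊗c N" := (tens_bicom M N) : type_scope.

Section Restrict.
Variables (k : comPzRingType) (A B : kalg k).

Program Definition res_bimod (M : bimod B A) : bimod (base_alg k) A :=
  @Bimod k (base_alg k) A M (fun c m => kalg_in B c *^l m) (@ract _ _ _ M) _.
Next Obligation.
split=> *; rewrite ?rmorphD ?rmorphM ?rmorph1.
- exact: lactDr.
- exact: lactDl.
- exact: lactA.
- exact: lact1.
- exact: ractDl.
- exact: ractDr.
- exact: ractA.
- exact: ract1.
- exact: lract.
- exact: lract_k.
Qed.

Variable C : coring A.

Program Definition res_bicom (M : bicom B C) : bicom (base_alg k) C :=
  @Bicom k A (base_alg k) C (res_bimod M) (@coact _ _ _ _ M) _.
Next Obligation.
have [[[hD hl] [_ hr]] hass hc] := bicomP M.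
by split=> //; split; split=> // c m; apply: hl.
Qed.

End Restrict.

Section Extension.
Variables (k : comPzRingType) (A L : kalg k) (C : coring A) (D : coring L).

(* (D : L) is a right extension of (C : A): a further right L-action and a
   right D-coaction tau_C on C making it a C-D bicomodule. *)
Record right_ext := RightExt {
  ext_ract : C -> L -> C;
  ext_bimodP : bimod_axioms (@lact _ _ _ C) ext_ract;
  ext_coact : Bimod ext_bimodP -> Bimod ext_bimodP ⊗ D;
  ext_bicomP : bicom_axioms ext_coact;
  ext_copP : is_comap (M := Bicom ext_bicomP) (N := C ⊗c Bicom ext_bicomP)
               (@cop _ _ C)
}.

Variable E : right_ext.

Definition ext_bimod : bimod A L := Bimod (ext_bimodP E).
Definition ext_bicom : bicom A D := Bicom (ext_bicomP E).

Section Induced.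
Variables (B : kalg k) (M : bicom B C).

(* m l = m^[0] eps_C (m^[1] l) *)
Definition ind_ract (m : M) (l : L) : M :=
  \tsum_(m0, m1 <- coact m) (m0 *^r cou (ext_ract E m1 l)).

Let rhoM : is_bimap (@coact _ _ _ _ M). Proof. exact: coact_bimap (bicomP M). Qed.
Let rhol : is_lmap (@coact _ _ _ _ M). Proof. by case: rhoM. Qed.
Let rhor : is_rmap (@coact _ _ _ _ M). Proof. by case: rhoM. Qed.
Let coul : is_lmap (N := reg_bimod A) (@cou _ _ C).
Proof. by case: (cou_bimap (corP C)). Qed.
Let copl : is_lmap (@cop _ _ C).
Proof. by case: (cop_bimap (corP C)). Qed.

Lemma ind_bal (N : bimod B A) l : balanced (@ract _ _ _ N) (@lact _ _ _ C)
  (fun m c => m *^r cou (ext_ract E c l)).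
Proof.
have [_ _ _ _ rD _ _ _ lr _] := ext_bimodP E.
by split=> *; rewrite ?ractDl ?rD ?(lmapD coul) ?ractDr ?lr ?(lmapl coul)
  //= ractA.
Qed.

Lemma ind_ractE m l :
  ind_ract m l = ru (tens_r (N := ext_bimod) (coact m) l : M ⊗ C).
Proof.
rewrite /ind_ract; move: (coact m); apply: tens_ext => [x y|x y|m0 c].
- exact: tliftD (ind_bal M l) _ _.
- by rewrite tens_rD ruD.
- by rewrite (tliftE (ind_bal M l)) tens_rE ruE.
Qed.

Lemma coact_ind m l :
  coact (ind_ract m l) = tens_r (N := ext_bimod) (coact m) l.
Proof.
pose h (z : C ⊗ C) : C := ru (tens_r (N := ext_bimod) z l).
have hD x y : h (x + y) = h x + h y by rewrite /h tens_rD ruD.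
have hE c c' : h (c ⊗e c') = c *^r cou (ext_ract E c' l).
  by rewrite /h tens_rE ruE.
have hl : is_lmap (M := C ⊗ C) h.
  split=> // a; apply: tens_ext => [x y|x y|c c'].
  - by rewrite /= tens_lD hD.
  - by rewrite hD lactDr.
  - by rewrite /= tens_lE !hE lract.
have hcop c : h (cop c) = ext_ract E c l.
  rewrite -[RHS](cop_cour (corP C)) /h; congr ru.
  by have [_ [[_ copr] _]] := ext_copP E; symmetry; apply: copr.
have rE (m0 : M) (a : A) : coact (m0 *^r a) = tens_r (coact m0) a.
  by rewrite (rmapr rhor).
transitivity ((id ⊗m h) ((id ⊗m (@cop _ _ C)) (coact m))); last first.
  move: (coact m); apply: tens_ext => [x y|x y|m0 c].
  - by rewrite !tmapD.
  - by rewrite tens_rD.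
  - by rewrite !tmapE // hcop tens_rE.
rewrite -(coact_coassoc (bicomP M)) /ind_ract.
have bal := ind_bal M l.
move: (coact m); apply: tens_ext => [x y|x y|m0 c].
- by rewrite (tliftD bal) (rmapD rhor).
- by rewrite tmapD // tassocD tmapD.
rewrite (tliftE bal) tmapE // rE.
move: (coact m0); apply: tens_ext => [x y|x y|m1 c1].
- by rewrite tens_rD.
- by rewrite tens_eltDl tassocD tmapD.
- by rewrite tens_rE tassocE tmapE // hE.
Qed.

Lemma coact_inj (m m' : M) : coact m = coact m' -> m = m'.
Proof.
move=> e; rewrite -(coact_cou (bicomP M) m) -(coact_cou (bicomP M) m').
by rewrite e.
Qed.

Lemma ind_bimodP : bimod_axioms (@lact _ _ _ M) ind_ract.
Proof.
have inj := @coact_inj.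
have P := bimodP (M ⊗ ext_bimod).
split.
- exact: lactDr.
- exact: lactDl.
- exact: lactA.
- exact: lact1.
- move=> x y l; apply: inj; rewrite (rmapD rhor) !coact_ind (rmapD rhor).
  exact: (bimod_rDl P).
- move=> x l l'; apply: inj; rewrite (rmapD rhor) !coact_ind.
  exact: (bimod_rDr P).
- move=> x l l'; apply: inj; rewrite !coact_ind; exact: (bimod_rA P).
- move=> x; apply: inj; rewrite !coact_ind; exact: (bimod_r1 P).
- move=> b x l; apply: inj; rewrite coact_ind !(lmapl rhol) coact_ind.
  exact: (bimod_lr P).
- move=> c x; apply: inj; rewrite coact_ind (lmapl rhol).
  exact: (bimod_k P).
Qed.

Definition ind_bimod : bimod B L := Bimod ind_bimodP.

Lemma coact_ind_bimap : is_bimap (M := ind_bimod) (N := M ⊗ ext_bimod)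
  (@coact _ _ _ _ M).
Proof.
split; split; try exact: (rmapD rhor); first exact: (lmapl rhol).
exact: coact_ind.
Qed.

(* rho ⊗_A C and M ⊗_A Delta_C *)
Definition coactC : M ⊗ ext_bimod -> (M ⊗ C) ⊗ ext_bimod :=
  tmap (M' := M ⊗ C) (@coact _ _ _ _ M) id.

Definition copC : M ⊗ ext_bimod -> (M ⊗ C) ⊗ ext_bimod :=
  fun z => tassocV (P := ext_bimod)
    (tmap (N := ext_bimod) (N' := C ⊗ ext_bimod) id (@cop _ _ C) z).

Lemma cop_ext_bimap : is_bimap (M := ext_bimod) (N := C ⊗ ext_bimod) (@cop _ _ C).
Proof. by case: (ext_copP E) => ? []. Qed.

Lemma coactC_rmap : is_rmap (M := M ⊗ ext_bimod) (N := (M ⊗ C) ⊗ ext_bimod) coactC.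
Proof. by apply: is_rmap_tmap. Qed.

Lemma copC_rmap : is_rmap (M := M ⊗ ext_bimod) (N := (M ⊗ C) ⊗ ext_bimod) copC.
Proof.
have [_ tr] := tassocV_bimap M C ext_bimod.
have cr : is_rmap (M := M ⊗ ext_bimod) (N := M ⊗ (C ⊗ ext_bimod))
    (tmap (N := ext_bimod) (N' := C ⊗ ext_bimod) id (@cop _ _ C)).
  by apply: is_rmap_tmap => //; apply: cop_ext_bimap.
split=> [x y|x b]; rewrite /copC.
- exact: etrans (congr1 _ (rmapD cr x y)) (rmapD tr _ _).
- exact: etrans (congr1 _ (rmapr cr x b)) (rmapr tr _ _).
Qed.

End Induced.

Arguments coactC {B} M z.
Arguments copC {B} M z.

Definition tmapDD (B B' : kalg k) (M : bimod B L) (M' : bimod B' L)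
  (f : M -> M') : M ⊗ D ⊗ D -> M' ⊗ D ⊗ D := (f ⊗m id) ⊗m id.

Definition is_equalizer (A1 A2 : kalg k) (X Y Z : bimod A1 A2)
    (f : X -> Y) (g h : Y -> Z) : Prop :=
  [/\ is_bimap f, is_bimap g, is_bimap h, g \o f =1 h \o f &
   forall (W : bimod A1 A2) (u : W -> Y), is_bimap u -> g \o u =1 h \o u ->
     exists! v : W -> X, is_bimap v /\ f \o v =1 u].

(* For every right C-comodule (M, rho), the equalizer of rho ⊗ C and
   M ⊗ Delta_C is preserved by - ⊗_L D ⊗_L D. *)
Definition pure_ext : Prop :=
  forall M : bicom (base_alg k) C,
  let X := ind_bimod M in
  let Y := M ⊗ ext_bimod in
  let Z := (M ⊗ C) ⊗ ext_bimod in
  is_equalizer (X := X ⊗ D ⊗ D) (Y := Y ⊗ D ⊗ D) (Z := Z ⊗ D ⊗ D)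
    (tmapDD (M := X) (M' := Y) (@coact _ _ _ _ M))
    (tmapDD (M := Y) (M' := Z) (coactC M))
    (tmapDD (M := Y) (M' := Z) (copC M)).

End Extension.

Arguments coactC {k A L C D} E {B} M z.
Arguments copC {k A L C D} E {B} M z.
Arguments tmapDD {k L} D {B B' M M'} f z.

Section EqualizerFacts.
Variables (k : comPzRingType) (L : kalg k) (D : coring L).

Lemma equalizer_elt (X Y Z : bimod (base_alg k) L) (f : X -> Y) (g h : Y -> Z) :
  is_equalizer f g h ->
  injective f /\ (forall y, g y = h y -> exists x, f x = y).
Proof.
move=> [[fl fr] [gl gr] [hl hr] gfh U].
pose W := res_bimod (reg_bimod L).
have uB (N : bimod (base_alg k) L) (y : N) : is_bimap (fun l : W => y *^r l).
  split; split=> *; rewrite /= ?ractDr ?ractA // -lract_k lract //.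
have H y : g y = h y -> exists! v : W -> X,
    is_bimap v /\ f \o v =1 (fun l : W => y *^r l).
  move=> gh; apply: U => // l.
  by rewrite /= (rmapr gr) (rmapr hr) gh.
split=> [x x' fxx|y /H [v [[vB fv] _]]].
- have /H [v [_ vU]] : g (f x) = h (f x) by apply: gfh.
  have e1 : v = (fun l : W => x *^r l).
    by apply: vU; split=> // l; rewrite /= (rmapr fr).
  have e2 : v = (fun l : W => x' *^r l).
    by apply: vU; split=> // l; rewrite /= (rmapr fr) fxx.
  by rewrite -(ract1 x) -(ract1 x') -[LHS]/((fun l : W => x *^r l) 1) -e1 e2.
- by exists (v (1 : L)); rewrite -[LHS]/((f \o v) _) fv ract1.
Qed.

Lemma ru_nat (B B' : kalg k) (M : bimod B L) (N : bimod B' L) (f : M -> N)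
    (z : M ⊗ D) : is_rmap f -> ru ((f ⊗m id) z) = f (ru z).
Proof.
move=> fM; move: z; apply: tens_ext => [x y|x y|m d].
- by rewrite tmapD // ruD.
- by rewrite ruD (rmapD fM).
- by rewrite tmapE // !ruE (rmapr fM).
Qed.

Lemma tens_coact_nat (B B' R : kalg k) (M : bimod B R) (M' : bimod B' R)
    (N : bicom R D) (f : M -> M') (z : M ⊗ N) : is_rmap f ->
  tens_coact ((f ⊗m id) z) = ((f ⊗m id) ⊗m id) (tens_coact z).
Proof.
move=> fM.
have ffM : is_rmap (M := M ⊗ N) (N := M' ⊗ N) (f ⊗m id) by apply: is_rmap_tmap.
move: z; apply: tens_ext => [x y|x y|m n].
- by rewrite tmapD // tens_coactD.
- by rewrite tens_coactD tmapD.
rewrite tmapE // !tens_coactE; move: (coact n); apply: tens_ext => [x y|x y|n0 d].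
- by rewrite tens_eltDr tassocVD.
- by rewrite tens_eltDr tassocVD tmapD.
- by rewrite !tassocVE !tmapE.
Qed.

Lemma ru_tens_coact (B R : kalg k) (M : bimod B R) (N : bicom R D) (z : M ⊗ N) :
  ru (tens_coact z) = z.
Proof. exact: coact_cou (tens_bicom_axioms M N) z. Qed.

(* If - ⊗_L D ⊗_L D preserves an equalizer then so does - ⊗_L D. *)
Lemma equalizer_retract (B1 B2 B3 : kalg k)
    (X : bimod B1 L) (Y : bimod B2 L) (Z : bimod B3 L)
    (f : X -> Y) (g h : Y -> Z) :
  is_rmap f -> is_rmap g -> is_rmap h ->
  injective (tmapDD D f) /\
    (forall y, tmapDD D g y = tmapDD D h y -> exists x, tmapDD D f x = y) ->
  let F' : X ⊗ D -> Y ⊗ D := f ⊗m id in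
  let G' : Y ⊗ D -> Z ⊗ D := g ⊗m id in
  let H' : Y ⊗ D -> Z ⊗ D := h ⊗m id in
  injective F' /\ (forall y, G' y = H' y -> exists x, F' x = y).
Proof.
move=> fM gM hM [Fi Fs] F' G' H'.
have FM : is_rmap F' by apply: is_rmap_tmap.
have F'F (x : X ⊗ D) : tens_coact (N := reg_bicom D) (F' x) =
    tmapDD D f (tens_coact (N := reg_bicom D) x) by apply: tens_coact_nat.
have G'G (x : Y ⊗ D) : tens_coact (N := reg_bicom D) (G' x) =
    tmapDD D g (tens_coact (N := reg_bicom D) x) by apply: tens_coact_nat.
have H'H (x : Y ⊗ D) : tens_coact (N := reg_bicom D) (H' x) =
    tmapDD D h (tens_coact (N := reg_bicom D) x) by apply: tens_coact_nat.
split=> [x x' e|y e].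
- rewrite -(ru_tens_coact (N := reg_bicom D) x).
  rewrite -(ru_tens_coact (N := reg_bicom D) x').
  by congr ru; apply: Fi; rewrite -!F'F e.
- have [|x Fx] := Fs (tens_coact (N := reg_bicom D) y).
    by rewrite -G'G -H'H e.
  exists (ru x); rewrite -(ru_tens_coact (N := reg_bicom D) y) -Fx.
  by symmetry; apply: ru_nat.
Qed.

Lemma tmap_id (B C : kalg k) (M : bimod B L) (N : bimod L C)
    (f : M -> M) z : f =1 id -> tmap (M := M) (N := N) f id z = z.
Proof.
move=> /funext ->; move: z.
by apply: (@tens_ext _ _ _ _ _ _ _ (id ⊗m id) id) => [x y|//|m n];
  rewrite ?tmapD ?tmapE.
Qed.

Lemma tmapDD_comp (B B' B'' : kalg k) (M : bimod B L) (M' : bimod B' L)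
    (M'' : bimod B'' L) (f : M -> M') (f' : M' -> M'') z :
  is_rmap f -> is_rmap f' -> tmapDD D f' (tmapDD D f z) = tmapDD D (f' \o f) z.
Proof.
move=> fM f'M; rewrite /tmapDD tmap_comp //; try exact: is_rmap_tmap.
by congr tmap; apply/funext => x; rewrite /= tmap_comp.
Qed.

Lemma tmapDD_id (B : kalg k) (M : bimod B L) (f : M -> M) z :
  f =1 id -> tmapDD D f z = z.
Proof. by move=> fid; apply: tmap_id => w; apply: tmap_id. Qed.

Lemma tmapDD_transport (B1 B2 B3 B1' B2' B3' : kalg k)
    (X : bimod B1 L) (Y : bimod B2 L) (Z : bimod B3 L)
    (X0 : bimod B1' L) (Y0 : bimod B2' L) (Z0 : bimod B3' L)
    (f : X -> Y) (g h : Y -> Z) (f0 : X0 -> Y0) (g0 h0 : Y0 -> Z0)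
    (a : X -> X0) (a' : X0 -> X) (b : Y -> Y0) (b' : Y0 -> Y) (c : Z -> Z0) :
  is_rmap f -> is_rmap g -> is_rmap h -> is_rmap f0 -> is_rmap g0 ->
  is_rmap h0 -> is_rmap a -> is_rmap a' -> is_rmap b -> is_rmap b' ->
  is_rmap c -> cancel a a' -> cancel a' a -> cancel b b' ->
  f0 \o a =1 b \o f -> g0 \o b =1 c \o g -> h0 \o b =1 c \o h ->
  injective (tmapDD D f0) /\
    (forall y, tmapDD D g0 y = tmapDD D h0 y -> exists x, tmapDD D f0 x = y) ->
  injective (tmapDD D f) /\
    (forall y, tmapDD D g y = tmapDD D h y -> exists x, tmapDD D f x = y).
Proof.
move=> fM gM hM f0M g0M h0M aM a'M bM b'M cM aK a'K bK.
move=> /funext fa /funext gb /funext hb [inj surj].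
have aaK : cancel (tmapDD D a) (tmapDD D a').
  by move=> z; rewrite tmapDD_comp // tmapDD_id.
have aaK' : cancel (tmapDD D a') (tmapDD D a).
  by move=> z; rewrite tmapDD_comp // tmapDD_id.
have bbK : cancel (tmapDD D b) (tmapDD D b').
  by move=> z; rewrite tmapDD_comp // tmapDD_id.
have sf x : tmapDD D f0 (tmapDD D a x) = tmapDD D b (tmapDD D f x).
  by rewrite [LHS]tmapDD_comp // [RHS]tmapDD_comp // fa.
have sg x : tmapDD D g0 (tmapDD D b x) = tmapDD D c (tmapDD D g x).
  by rewrite [LHS]tmapDD_comp // [RHS]tmapDD_comp // gb.
have sh x : tmapDD D h0 (tmapDD D b x) = tmapDD D c (tmapDD D h x).
  by rewrite [LHS]tmapDD_comp // [RHS]tmapDD_comp // hb.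
split=> [x x' e|y e].
- by apply: (can_inj aaK); apply: inj; rewrite !sf e.
- have [|x0 x0E] := surj (tmapDD D b y); first by rewrite sg sh e.
  by exists (tmapDD D a' x0); apply: (can_inj bbK); rewrite -sf aaK'.
Qed.

End EqualizerFacts.

Section InducedComodule.
Variables (k : comPzRingType) (A L : kalg k) (C : coring A) (D : coring L).
Variables (E : right_ext C D) (pureE : pure_ext E).
Variables (B : kalg k) (M : bicom B C).

Let ML := ind_bimod E M.
Let CL := ext_bimod E.
Let CD := ext_bicom E.

Let rhoB : is_bimap (M := ML) (N := M ⊗ CL) (@coact _ _ _ _ M).
Proof. exact: coact_ind_bimap. Qed.
Let rhor : is_rmap (M := ML) (N := M ⊗ CL) (@coact _ _ _ _ M).
Proof. by case: rhoB. Qed.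
Let rhor' : is_rmap (M := M) (N := M ⊗ C) (@coact _ _ _ _ M).
Proof. by case: (coact_bimap (bicomP M)). Qed.
Let copB : is_bimap (M := CL) (N := C ⊗ CL) (@cop _ _ C).
Proof. by case: (ext_copP E) => ? []. Qed.
Let copl : is_lmap (M := CL) (N := C ⊗ CL) (@cop _ _ C).
Proof. by case: copB. Qed.
Let taul : is_lmap (M := CL) (N := CL ⊗ D) (@coact _ _ _ _ CD).
Proof. by case: (coact_bimap (bicomP CD)). Qed.

Definition rhoD : ML ⊗ D -> (M ⊗ CL) ⊗ D :=
  tmap (M := ML) (M' := M ⊗ CL) (@coact _ _ _ _ M) id.

Lemma pure_elt1 :
  injective (tmapDD D (M := ML) (M' := M ⊗ CL) (@coact _ _ _ _ M)) /\
  (forall y, tmapDD D (coactC E M) y = tmapDD D (copC E M) y ->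
     exists x, tmapDD D (M := ML) (M' := M ⊗ CL) (@coact _ _ _ _ M) x = y).
Proof.
pose M0 := res_bicom M.
pose a : ML -> ind_bimod E M0 := id.
pose a' : ind_bimod E M0 -> ML := id.
pose b : M ⊗ CL -> M0 ⊗ CL := tmap (M := M) (M' := M0) id id.
pose b' : M0 ⊗ CL -> M ⊗ CL := tmap (M := M0) (M' := M) id id.
pose c : (M ⊗ C) ⊗ CL -> (M0 ⊗ C) ⊗ CL :=
  tmap (M := M ⊗ C) (M' := M0 ⊗ C) (tmap (M := M) (M' := M0) id id) id.
have bE (L' : kalg k) (P : bimod A L') (z : M ⊗ P) :
    tmap (M := M) (M' := M0) (N := P) id id z = z :> tensor _ _.
  move: z; apply: (@tens_ext _ _ _ _ _ _ _
    (tmap (M := M) (M' := M0) (N := P) id id) id) => [x y|//|m n].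
    by rewrite tmapD.
  by rewrite tmapE.
have aM : is_rmap a by [].
have a'M : is_rmap a' by [].
have iM : is_rmap (M := M) (N := M0) id by [].
have iM' : is_rmap (M := M0) (N := M) id by [].
have iM2 : is_rmap (M := M ⊗ C) (N := M0 ⊗ C)
    (tmap (M := M) (M' := M0) id id) by apply: is_rmap_tmap.
have bM : is_rmap b by apply: is_rmap_tmap.
have b'M : is_rmap b' by apply: is_rmap_tmap.
have cM : is_rmap c by apply: is_rmap_tmap.
have bK : cancel b b' by move=> z; rewrite /b /b' tmap_comp // tmap_id.
have coactE m : coact (b := M0) m = coact (b := M) m by [].
apply: (@tmapDD_transport _ _ D _ _ _ _ _ _ ML (M ⊗ CL) ((M ⊗ C) ⊗ CL)
  (ind_bimod E M0) (M0 ⊗ CL) ((M0 ⊗ C) ⊗ CL)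
  _ _ _ _ _ _ a a' b b' c _ _ _ _ _ _ _ _ _ _ _ _ _ _ _ _ _
  (equalizer_elt (pureE M0))) => //.
- exact: coactC_rmap.
- exact: copC_rmap.
- by case: (coact_ind_bimap E M0).
- exact: coactC_rmap.
- exact: copC_rmap.
- by move=> m; rewrite /= /a /b bE.
- apply: tens_ext => [x y|x y|m x]; rewrite /= /b /c.
  + by rewrite tmapD // (rmapD (coactC_rmap E M0)).
  + by rewrite (rmapD (coactC_rmap E M)) tmapD.
  + rewrite tmapE // /coactC !tmapE //; last first.
      by case: (coact_bimap (bicomP M0)).
    exact: (congr1 (fun z => tens_elt (M := M0 ⊗ C) (N := CL) z x)
      (esym (bE _ C (coact m)))).
- apply: tens_ext => [x y|x y|m x]; rewrite /= /b /c.
  + by rewrite tmapD // (rmapD (copC_rmap E M0)).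
  + by rewrite (rmapD (copC_rmap E M)) tmapD.
  rewrite tmapE // /copC !tmapE //; try exact: copl.
  move: (cop x); apply: tens_ext => [y z|y z|c1 c2].
  + by rewrite tens_eltDr tassocVD.
  + by rewrite tens_eltDr tassocVD tmapD.
  + by rewrite !tassocVE !tmapE.
Qed.

Lemma pure_elt : injective rhoD /\ forall y : (M ⊗ CL) ⊗ D,
  (coactC E M ⊗m id) y = (copC E M ⊗m id) y -> exists x, rhoD x = y.
Proof.
exact: equalizer_retract rhor (coactC_rmap E M) (copC_rmap E M) pure_elt1.
Qed.

(* m^[0] ⊗_A tau_C (m^[1]) *)
Definition coactCD (m : M) : (M ⊗ CL) ⊗ D :=
  @coact _ _ _ _ (M ⊗c CD) (coact m).

Lemma coactCD_equal m : (coactC E M ⊗m id) (coactCD m) = (copC E M ⊗m id) (coactCD m).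
Proof.
pose P (z : (M ⊗ C) ⊗ CL) : ((M ⊗ C) ⊗ CL) ⊗ D := tens_coact (N := CD) z.
have PD x y : P (x + y) = P x + P y by rewrite /P (tens_coactD (N := CD)).
transitivity (P (coactC E M (coact m))).
  by symmetry; apply: (tens_coact_nat (N := CD) _ rhor').
have -> : coactC E M (coact m) = copC E M (coact m).
  rewrite /copC -[X in tassocV X](coact_coassoc (bicomP M)).
  by rewrite -[LHS](@tassocK _ _ _ _ _ M C CL).
rewrite /coactCD.
move: (coact m); apply: tens_ext => [x y|x y|m0 c].
- by rewrite (rmapD (copC_rmap E M)) PD.
- by rewrite [coact _]tens_coactD tmapD //; apply: copC_rmap.
rewrite [coact _](tens_coactE (N := CD)) /copC tmapE //.
pose Q (w : (C ⊗ CL) ⊗ D) : ((M ⊗ C) ⊗ CL) ⊗ D :=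
  tmap (M := M ⊗ (C ⊗ CL)) (M' := (M ⊗ C) ⊗ CL)
    (@tassocV _ _ _ _ _ M C CL) id
    (tassocV (N := C ⊗ CL) (m0 ⊗e w)).
have aV : is_rmap (M := M ⊗ (C ⊗ CL)) (N := (M ⊗ C) ⊗ CL)
    (@tassocV _ _ _ _ _ M C CL) by case: (tassocV_bimap M C CL).
have QD x y : Q (x + y) = Q x + Q y by rewrite /Q tens_eltDr tassocVD tmapD.
have QE (x : C ⊗ CL) d : Q (x ⊗e d) = tassocV (P := CL) (m0 ⊗e x) ⊗e d.
  by rewrite /Q tassocVE tmapE.
transitivity (Q (tens_coact (N := CD) (cop c))).
  move: (cop c); apply: tens_ext => [x y|x y|c1 c2].
  - by rewrite tens_eltDr tassocVD PD.
  - by rewrite (tens_coactD (N := CD)) QD.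
  rewrite tassocVE /P !(tens_coactE (N := CD)).
  move: (coact (b := CD) c2); apply: tens_ext => [x y|x y|c3 d].
  - by rewrite tens_eltDr tassocVD.
  - by rewrite tens_eltDr tassocVD QD.
  - by rewrite !tassocVE QE tassocVE.
have -> : tens_coact (N := CD) (cop c) =
    tmap (M := CL) (M' := C ⊗ CL) (@cop _ _ C) id (coact (b := CD) c).
  by have [_ [_ ]] := ext_copP E; apply.
have copr : is_rmap (M := CL) (N := C ⊗ CL) (@cop _ _ C) by case: copB.
move: (coact (b := CD) c); apply: tens_ext => [x y|x y|c1 d].
- by rewrite tmapD // QD.
- by rewrite tens_eltDr tassocVD tmapD //; apply: copC_rmap.
rewrite tmapE // QE tassocVE tmapE //; last exact: copC_rmap.
by rewrite /copC tmapE.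
Qed.


(* tau_M(m) = m^[0] eps_C(m^[1]_[0]) ⊗_L m^[1]_[1]. As M ⊗_A eps_C need not be
   right L-linear, this stands for the unique element of M ⊗_L D that
   rho_M ⊗_L D maps to m^[0] ⊗_A tau_C(m^[1]); it exists by purity. *)
Definition ind_coact (m : M) : ML ⊗ D :=
  projT1 (cid (proj2 pure_elt _ (coactCD_equal m))).

Lemma ind_coactP m : rhoD (ind_coact m) = coactCD m.
Proof. by rewrite /ind_coact; case: cid. Qed.

Lemma rhoD_inj : injective rhoD.
Proof. by case: pure_elt. Qed.

Lemma rhoDD_inj :
  injective (tmapDD D (M := ML) (M' := M ⊗ CL) (@coact _ _ _ _ M)).
Proof. by case: pure_elt1. Qed.

Lemma rhoD_bimap : is_bimap (M := ML ⊗ D) (N := (M ⊗ CL) ⊗ D) rhoD.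
Proof. by split; [apply: is_lmap_tmap | apply: is_rmap_tmap]. Qed.

Lemma coactCD_bimap : is_bimap (M := ML) (N := (M ⊗ CL) ⊗ D) coactCD.
Proof.
have [tl tr] := tens_coact_bimap M CD; have [rl _] := rhoB.
split; split=> *; rewrite /coactCD.
- exact: etrans (congr1 _ (rmapD rhor _ _)) (rmapD tr _ _).
- exact: etrans (congr1 _ (lmapl rl _ _)) (lmapl tl _ _).
- exact: etrans (congr1 _ (rmapD rhor _ _)) (rmapD tr _ _).
- exact: etrans (congr1 _ (rmapr rhor _ _)) (rmapr tr _ _).
Qed.

Lemma ind_coact_bimap : is_bimap (M := ML) (N := ML ⊗ D) ind_coact.
Proof.
have [rl rr] := rhoD_bimap; have [cl cr] := coactCD_bimap.
split; split=> *; apply: rhoD_inj; rewrite ?(rmapD rr) ?(rmapr rr) ?(lmapl rl).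
- by rewrite !ind_coactP (rmapD cr).
- by rewrite !ind_coactP (lmapl cl).
- by rewrite !ind_coactP (rmapD cr).
- by rewrite !ind_coactP (rmapr cr).
Qed.

Lemma ind_bicomP : bicom_axioms (M := ML) ind_coact.
Proof.
have [tl tr] := ind_coact_bimap.
have [_ cr] := coactCD_bimap.
have [_ tcr] := tens_coact_bimap M CD.
split; first exact: ind_coact_bimap.
- move=> m.
  apply: (can_inj (@tassocVK _ _ _ _ _ ML D D)); rewrite tassocK.
  apply: rhoDD_inj; rewrite /tmapDD -/rhoD.
  transitivity (tens_coact (N := reg_bicom D) (rhoD (ind_coact m))); last first.
    exact: (tens_coact_nat (N := reg_bicom D)).
  have -> : (rhoD ⊗m id) (tmap (M := ML) (M' := ML ⊗ D) ind_coact id (ind_coact m)) =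
      tmap (M := ML) (M' := (M ⊗ CL) ⊗ D) coactCD id (ind_coact m).
    rewrite tmap_comp //; last by case: rhoD_bimap.
    by congr (tmap _ _ _); apply/funext => x /=; rewrite ind_coactP.
  have -> : tmap (M := ML) (M' := (M ⊗ CL) ⊗ D) coactCD id (ind_coact m) =
      tmap (M := M ⊗ CL) (M' := (M ⊗ CL) ⊗ D) (@coact _ _ _ _ (M ⊗c CD)) id
        (rhoD (ind_coact m)).
    by rewrite /rhoD tmap_comp.
  rewrite ind_coactP.
  have := coact_coassoc (bicomP (M ⊗c CD)) (coact m).
  by move=> e; rewrite -[LHS](@tassocK _ _ _ _ _ (M ⊗ CL) D D) e.
- move=> m; apply: (@coact_inj _ _ _ _ M).
  rewrite -[LHS](ru_nat (M := ML) (N := M ⊗ CL) _ rhor).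
  rewrite -[LHS]/(ru (rhoD (ind_coact m))) ind_coactP.
  exact: (ru_tens_coact (N := CD)).
Qed.

(* Every right C-comodule is a right D-comodule. *)
Definition ind_bicom : bicom B D := Bicom ind_bicomP.

End InducedComodule.

Section RmapZmod.
Variables (k : comPzRingType) (A B R : kalg k) (M : bimod R A) (N : bimod B A).

Lemma lact0 a : a *^l (0 : N) = 0.
Proof. by apply: (@addrI _ (a *^l 0)); rewrite -lactDr !addr0. Qed.
Lemma ract0 a : (0 : N) *^r a = 0.
Proof. by apply: (@addrI _ (0 *^r a)); rewrite -ractDl !addr0. Qed.
Lemma lactN a (x : N) : a *^l (- x) = - (a *^l x).
Proof. by apply: (@addrI _ (a *^l x)); rewrite -lactDr !subrr lact0. Qed.
Lemma ractN (x : N) a : (- x) *^r a = - (x *^r a).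
Proof. by apply: (@addrI _ (x *^r a)); rewrite -ractDl !subrr ract0. Qed.

Lemma rmap0 (f : M -> N) : is_rmap f -> f 0 = 0.
Proof. by move=> fM; apply: (@addrI _ (f 0)); rewrite -(rmapD fM) !addr0. Qed.
Lemma rmapB (f : M -> N) x y : is_rmap f -> f (x - y) = f x - f y.
Proof.
by move=> fM; apply: (@addIr _ (f y)); rewrite -(rmapD fM) !subrK.
Qed.

Lemma is_rmap0 : is_rmap (0 : M -> N).
Proof.
split=> [x y|x b]; first exact: (esym (addr0 (0 : N))).
exact: (esym (ract0 b)).
Qed.

Lemma is_rmapB (f g : M -> N) : is_rmap f -> is_rmap g -> is_rmap (f - g).
Proof.
move=> fM gM; split=> [x y|x b].
- rewrite -[LHS]/(f (x + y) - g (x + y)) -[RHS]/((f x - g x) + (f y - g y)).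
  by rewrite (rmapD fM) (rmapD gM) opprD addrACA.
- rewrite -[LHS]/(f (x *^r b) - g (x *^r b)) -[RHS]/((f x - g x) *^r b).
  by rewrite (rmapr fM) (rmapr gM) ractDl ractN.
Qed.

End RmapZmod.

Section RightHom.
Variables (k : comPzRingType) (A B R : kalg k) (M : bimod R A) (N : bimod B A).

Definition rmap_pred : {pred M -> N} := fun f => `[< is_rmap f >].

(* Hom_A(M, N) *)
Record rhom := RHom {
  rhom_fun :> M -> N;
  rhomb : rhom_fun \in rmap_pred
}.
HB.instance Definition _ := [isSub for rhom_fun].
HB.instance Definition _ := [Choice of rhom by <:].

Lemma rhomP (f : rhom) : is_rmap f.
Proof. by case: f => f /= /asboolP. Qed.

Definition mk_rhom (f : M -> N) (fM : is_rmap f) : rhom :=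
  RHom (asboolT fM : f \in rmap_pred).

Lemma rhom_inj (f g : rhom) : f =1 g -> f = g.
Proof. by move=> /funext fg; apply: val_inj. Qed.

Fact rmap_zmod_closed : GRing.zmod_closed rmap_pred.
Proof.
split=> [|f g]; rewrite !unfold_in; first by apply/asboolP; apply: is_rmap0.
by move=> /asboolP fM /asboolP gM; apply/asboolP; apply: is_rmapB.
Qed.
HB.instance Definition _ :=
  GRing.isZmodClosed.Build (M -> N) rmap_pred rmap_zmod_closed.
HB.instance Definition _ := [SubChoice_isSubZmodule of rhom by <:].

Fact rhom_l_rmap (b : B) (f : rhom) : is_rmap (fun x => b *^l f x).
Proof.
by split=> *; rewrite ?(rmapD (rhomP f)) ?(rmapr (rhomP f)) ?lactDr ?lract.
Qed.

Fact rhom_r_rmap (f : rhom) (r : R) : is_rmap (fun x : M => f (r *^l x)).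
Proof. by split=> *; rewrite ?lactDr -?lract -?(rmapD (rhomP f)) ?(rmapr (rhomP f)). Qed.

Definition rhom_l (b : B) (f : rhom) : rhom := mk_rhom (rhom_l_rmap b f).
Definition rhom_r (f : rhom) (r : R) : rhom := mk_rhom (rhom_r_rmap f r).

Fact rhom_bimodP : bimod_axioms rhom_l rhom_r.
Proof.
split=> *; apply: rhom_inj => z //=.
- exact: lactDr.
- exact: lactDl.
- exact: lactA.
- exact: lact1.
- by rewrite lactDl (rmapD (rhomP _)).
- by rewrite lactA.
- by rewrite lact1.
- by rewrite lract_k -(rmapr (rhomP _)) lract_k.
Qed.

(* Hom_A(M, N) as a bimodule: (b f r)(x) = b f(r x). *)
Canonical rhom_bimod : bimod B R := Bimod rhom_bimodP.

End RightHom.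

Section EndComodule.
Variables (k : comPzRingType) (A B : kalg k) (C : coring A) (M : bicom B C).

Definition rcomap_pred : {pred M -> M} :=
  fun f => `[< is_rcomap (M := M) (N := M) f >].

(* T = End^C(M); its elements are right C-colinear, not left B-linear. *)
Record cend := CEnd {
  cend_fun :> M -> M;
  cendb : cend_fun \in rcomap_pred
}.
HB.instance Definition _ := [isSub for cend_fun].
HB.instance Definition _ := [Choice of cend by <:].

Lemma cendP (f : cend) : is_rcomap (M := M) (N := M) f.
Proof. by case: f => f /= /asboolP. Qed.

Definition mk_cend (f : M -> M) (fM : is_rcomap (M := M) (N := M) f) : cend :=
  CEnd (asboolT fM : f \in rcomap_pred).

Lemma cend_inj (f g : cend) : f =1 g -> f = g.
Proof. by move=> /funext fg; apply: val_inj. Qed.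

Let rho0 : coact (0 : M) = 0.
Proof. by rewrite (rmap0 (proj2 (coact_bimap (bicomP M)))). Qed.
Let rhoB (x y : M) : coact (x - y) = coact x - coact y.
Proof. by rewrite (rmapB _ _ (proj2 (coact_bimap (bicomP M)))). Qed.

Fact rcomap_zmod_closed : GRing.zmod_closed rcomap_pred.
Proof.
split=> [|f g]; rewrite !unfold_in.
  apply/asboolP; split; first exact: is_rmap0.
  move=> m; rewrite rho0; move: (coact m).
  apply: (@tens_ext _ _ _ _ M C _ (fun=> 0)) => [x y|x y|x n].
  - by rewrite /= addr0.
  - by rewrite tmapD //; apply: is_rmap0.
  - rewrite tmapE //; last exact: is_rmap0.
    rewrite -[(0 : M -> M) x]/(0 : M); apply: (@addrI _ ((0 : M) ⊗e n)).
    by rewrite -tens_eltDl !addr0.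
move=> /asboolP [fM fE] /asboolP [gM gE]; apply/asboolP.
have fgM := is_rmapB fM gM; split=> // m.
rewrite -[(f - g) m]/(f m - g m) rhoB fE gE.
move: (coact m); apply: (@tens_ext _ _ _ _ M C _
  (fun z => (f ⊗m id) z - (g ⊗m id) z)) => [x y|x y|x c].
- by rewrite /= !tmapD // opprD addrACA.
- by rewrite tmapD.
- rewrite !tmapE // -[(f - g) x]/(f x - g x).
  apply: (@addIr _ (g x ⊗e c)); rewrite subrK.
  by rewrite -tens_eltDl subrK.
Qed.
HB.instance Definition _ :=
  GRing.isZmodClosed.Build (M -> M) rcomap_pred rcomap_zmod_closed.
HB.instance Definition _ := [SubChoice_isSubZmodule of cend by <:].

Fact cend1_rcomap : is_rcomap (M := M) (N := M) id.
Proof. by split=> // m; rewrite tmap_id. Qed.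

Fact cendM_rcomap (f g : cend) : is_rcomap (M := M) (N := M) (f \o g).
Proof.
have [fM fE] := cendP f; have [gM gE] := cendP g.
split=> [|m]; last by rewrite /= fE gE tmap_comp.
by split=> *; rewrite /= ?(rmapD gM) ?(rmapr gM) ?(rmapD fM) ?(rmapr fM).
Qed.

Definition cend1 : cend := mk_cend cend1_rcomap.
Definition cend_mul (f g : cend) : cend := mk_cend (cendM_rcomap f g).

Fact cend_mulA : associative cend_mul.
Proof. by move=> f g h; apply: cend_inj. Qed.
Fact cend_mul1l : left_id cend1 cend_mul.
Proof. by move=> f; apply: cend_inj. Qed.
Fact cend_mul1r : right_id cend1 cend_mul.
Proof. by move=> f; apply: cend_inj. Qed.
Fact cend_mulDl : left_distributive cend_mul +%R.
Proof. by move=> f g h; apply: cend_inj. Qed.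
Fact cend_mulDr : right_distributive cend_mul +%R.
Proof.
by move=> f g h; apply: cend_inj => x; apply: (rmapD (rcomap_rmap (cendP f))).
Qed.
HB.instance Definition _ := GRing.Zmodule_isPzRing.Build cend
  cend_mulA cend_mul1l cend_mul1r cend_mulDl cend_mulDr.

Fact cend_in_rcomap (b : B) : is_rcomap (M := M) (N := M) (fun x => b *^l x).
Proof.
split; first exact: is_rmap_l.
by move=> m; rewrite (lmapl (proj1 (coact_bimap (bicomP M)))).
Qed.

(* The ring map B -> T, b |-> (x |-> b x). *)
Definition cend_in (b : B) : cend := mk_cend (cend_in_rcomap b).

Fact cend_in_zmod : zmod_morphism cend_in.
Proof.
move=> b b'; apply: cend_inj => x.
rewrite -[RHS]/(b *^l x - b' *^l x) /=; apply: (@addIr _ (b' *^l x)).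
by rewrite subrK -lactDl subrK.
Qed.
Fact cend_in_monoid : monoid_morphism cend_in.
Proof.
split=> [|b b']; apply: cend_inj => x /=; [exact: lact1 | exact: lactA].
Qed.
HB.instance Definition _ := GRing.isZmodMorphism.Build B cend cend_in cend_in_zmod.
HB.instance Definition _ :=
  GRing.isMonoidMorphism.Build B cend cend_in cend_in_monoid.

Fact cend_central c (f : cend) :
  (cend_in \o kalg_in B) c * f = f * (cend_in \o kalg_in B) c.
Proof.
apply: cend_inj => x /=; rewrite !lract_k.
by rewrite (rmapr (rcomap_rmap (cendP f))).
Qed.

Definition cend_alg : kalg k :=
  @KAlg k cend (cend_in \o kalg_in B) cend_central.

(* M as a T-C bicomodule, by evaluation. *)
Fact eval_bimodP : bimod_axioms (fun (t : cend_alg) (x : M) => t x) (@ract _ _ _ M).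
Proof.
split=> *; rewrite ?(rmapD (rcomap_rmap (cendP _))) ?(rmapr (rcomap_rmap (cendP _))) //.
- exact: ractDl.
- exact: ractDr.
- exact: ractA.
- exact: ract1.
- exact: lract_k.
Qed.

Fact eval_bicomP : bicom_axioms (M := Bimod eval_bimodP) (@coact _ _ _ _ M).
Proof.
have [rl rr] := coact_bimap (bicomP M).
split; [|exact: coact_coassoc (bicomP M)|exact: coact_cou (bicomP M)].
split; last by split; [exact: (rmapD rr) | exact: (rmapr rr)].
by split; [exact: (lmapD rl) | move=> t x; apply: (rcomapE (cendP t))].
Qed.

Definition eval_bicom : bicom cend_alg C := Bicom eval_bicomP.

(* T as a T-B bimodule, along B -> T. *)
Fact cend_bimodP :
  bimod_axioms (fun (t u : cend_alg) => t * u) (fun t b => t * cend_in b).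
Proof.
split=> *; rewrite ?mulrDl ?mulrDr ?mulrA ?mul1r ?rmorphD ?rmorphM ?rmorph1
  ?mulrDr ?mulrA ?mulr1 //.
exact: cend_central.
Qed.

Definition cend_bimod : bimod cend_alg B := Bimod cend_bimodP.

End EndComodule.

Section BicomConstructions.
Variables (k : comPzRingType) (A B : kalg k) (C : coring A).

Definition bicom_iso (M N : bicom B C) : Prop :=
  exists (f : M -> N) (g : N -> M),
    [/\ is_comap f, is_comap g, cancel f g & cancel g f].

(* X is the direct sum of M and Z, with injections i, j and projections p, r. *)
Definition is_direct_sum (X M Z : bicom B C)
    (i : M -> X) (p : X -> M) (j : Z -> X) (r : X -> Z) : Prop :=
  [/\ is_comap i /\ is_comap p, is_comap j /\ is_comap r,
      cancel i p /\ cancel j r,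
      (forall z, p (j z) = 0) /\ (forall m, r (i m) = 0) &
      forall x, i (p x) + j (r x) = x].

Definition iso_direct_summand (M X : bicom B C) : Prop :=
  exists (Z : bicom B C) (i : M -> X) (p : X -> M) (j : Z -> X) (r : X -> Z),
    is_direct_sum i p j r.

End BicomConstructions.

Section Galois.
Variables (k : comPzRingType) (A B : kalg k) (C : coring A) (S : bicom B C).

(* phi ⊗_T x |-> phi(x^[0]) ⊗_A x^[1] *)
Definition can_elt (N : bimod (base_alg k) A)
    (phi : rhom_bimod (eval_bicom S) N) (x : eval_bicom S) : N ⊗ C :=
  \tsum_(x0, x1 <- coact x) (phi x0 ⊗e x1).

Definition can_map (N : bimod (base_alg k) A)
    (z : rhom_bimod (eval_bicom S) N ⊗ eval_bicom S) : N ⊗ C :=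
  \tsum_(phi, x <- z) can_elt phi x.

Lemma can_elt_bal (N : bimod (base_alg k) A) :
  balanced (@ract _ _ _ (rhom_bimod (eval_bicom S) N))
    (@lact _ _ _ (eval_bicom S)) (@can_elt N).
Proof.
have [rl rr] := coact_bimap (bicomP S).
split=> [f g x|f x y|f t x].
- rewrite /can_elt; move: (coact x).
  apply: tens_ext => [z z'|z z'|x0 x1].
  + by rewrite [LHS](tmapD (rhomP (f + g)) (@is_lmap_id _ _ _ C)).
  + rewrite [X in X + _ = _](tmapD (rhomP f) (@is_lmap_id _ _ _ C)).
    rewrite [X in _ + X = _](tmapD (rhomP g) (@is_lmap_id _ _ _ C)).
    exact: addrACA.
  + rewrite [LHS](tmapE (rhomP (f + g)) (@is_lmap_id _ _ _ C)).
    rewrite [X in _ = X + _](tmapE (rhomP f) (@is_lmap_id _ _ _ C)).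
    rewrite [X in _ = _ + X](tmapE (rhomP g) (@is_lmap_id _ _ _ C)).
    exact: tens_eltDl.
- rewrite /can_elt (rmapD rr).
  exact: (tmapD (rhomP f) (@is_lmap_id _ _ _ C)).
- have fM : is_rmap (M := S) (N := N) f.
    by split; [exact: rmapD (rhomP f) | exact: rmapr (rhomP f)].
  have -> : can_elt f (t *^l x) =
      tmap (M := S) (M' := N) f id (coact (b := S) (t x)) by [].
  by rewrite (rcomapE (cendP t)) (tmap_comp _ (rcomap_rmap (cendP t)) fM).
Qed.

Definition galois_comodule : Prop :=
  forall N : bimod (base_alg k) A, bijective (@can_map N).

End Galois.

Section Cleft.
Variables (k : comPzRingType) (A L : kalg k) (C : coring A) (D : coring L).
Variables (E : right_ext C D) (S : bicom L C).

(* Sigma^* as an A-L bimodule. *)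
Definition dual_bimod : bimod A L := rhom_bimod S (reg_bimod A).

Record Qtilde := QTilde {
  qt_fun :> ext_bimod E -> dual_bimod;
  qt_bimap : is_bimap qt_fun;
  qt_cop : forall (c : C) (x : S),
    \tsum_(c1, c2 <- cop c) (c1 *^r qt_fun c2 x) =
    \tsum_(x0, x1 <- coact x) (qt_fun c x0 *^l x1)
}.

(* q • p *)
Definition qp_bullet (q : Qtilde) (p : D -> S) (c : C) : C :=
  \tsum_(c0, d <- coact (b := ext_bicom E) c)
    \tsum_(x0, x1 <- coact (p d)) (q c0 x0 *^l x1).

(* the action of z in Sigma ⊗_A C: (y ⊗ c)(x) = y q(c)(x) *)
Definition qt_eval (q : Qtilde) (z : S ⊗ C) (x : S) : S :=
  \tsum_(y, c <- z) (y *^r q c x).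

Section QtildeFacts.
Variable q : Qtilde.
Let qD c c' x : q (c + c') x = q c x + q c' x.
Proof. by rewrite (lmapD (proj1 (qt_bimap q))). Qed.
Let ql a c x : q (a *^l c) x = a * q c x.
Proof. by rewrite (lmapl (proj1 (qt_bimap q))). Qed.
Let qDr c x y : q c (x + y) = q c x + q c y.
Proof. exact: rmapD (rhomP (q c)) _ _. Qed.
Let qr c x a : q c (x *^r a) = q c x * a.
Proof. exact: rmapr (rhomP (q c)) _ _. Qed.
Let qL c l x : q (ext_ract E c l) x = q c (l *^l x).
Proof. by rewrite (rmapr (proj2 (qt_bimap q)) c l). Qed.

Lemma qt_eval_bal (N : bimod L A) (x : S) : balanced (@ract _ _ _ N) (@lact _ _ _ C)
  (fun y c => y *^r q c x).
Proof.
by split=> *; rewrite ?ractDl ?qD ?ractDr ?ql ?ractA.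
Qed.

Lemma qt_cop_bal (c : C) : balanced (@ract _ _ _ S) (@lact _ _ _ C)
  (fun x0 x1 => q c x0 *^l x1).
Proof.
by split=> *; rewrite ?qDr ?lactDl ?lactDr ?qr ?lactA.
Qed.

Lemma qt_cop_bal' (x : S) : balanced (@ract _ _ _ C) (@lact _ _ _ C)
  (fun c1 c2 => c1 *^r q c2 x).
Proof.
by split=> *; rewrite ?ractDl ?qD ?ractDr ?ql ?ractA.
Qed.

Lemma qp_bullet_bal (p : D -> S) : is_lmap p ->
  balanced (@ract _ _ _ (ext_bimod E)) (@lact _ _ _ D)
  (fun c0 d => \tsum_(x0, x1 <- coact (p d)) (q c0 x0 *^l x1)).
Proof.
move=> pL; have [rl _] := coact_bimap (bicomP S); split=> [c c' d|c d d'|c l d].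
- move: (coact _); apply: tens_ext => [x y|x y|x0 x1].
  + exact: tliftD (qt_cop_bal _) _ _.
  + by rewrite !(tliftD (qt_cop_bal _)) addrACA.
  + by rewrite !(tliftE (qt_cop_bal _)) qD lactDl.
- by rewrite (lmapD pL) (lmapD rl) (tliftD (qt_cop_bal c)).
- rewrite (lmapl pL) (lmapl rl).
  move: (coact _); apply: tens_ext => [x y|x y|x0 x1].
  + exact: tliftD (qt_cop_bal _) _ _.
  + by rewrite /= tens_lD (tliftD (qt_cop_bal _)).
  + by rewrite /= tens_lE !(tliftE (qt_cop_bal _)) qL.
Qed.

Lemma qt_evalD z z' x : qt_eval q (z + z') x = qt_eval q z x + qt_eval q z' x.
Proof. exact: tliftD (qt_eval_bal S x) _ _. Qed.
Lemma qt_evalE y c x : qt_eval q (y ⊗e c) x = y *^r q c x.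
Proof. exact: tliftE (qt_eval_bal S x) _ _. Qed.

Lemma qt_eval_rmap z : is_rmap (M := S) (N := S) (qt_eval q z).
Proof.
split=> [x y|x a]; move: z; apply: tens_ext => [z z'|z z'|z c].
- exact: qt_evalD.
- by rewrite !qt_evalD addrACA.
- by rewrite !qt_evalE qDr ractDr.
- exact: qt_evalD.
- by rewrite qt_evalD ractDl.
- by rewrite !qt_evalE qr ractA.
Qed.

Fact qt_eval_rcomap (y : S) : is_rcomap (M := S) (N := S) (qt_eval q (coact y)).
Proof.
have [rl rr] := coact_bimap (bicomP S).
split=> [|x]; first exact: qt_eval_rmap.
pose h (z : C ⊗ C) : C := \tsum_(c1, c2 <- z) (c1 *^r q c2 x).
have hD z z' : h (z + z') = h z + h z' by apply: tliftD (qt_cop_bal' x) _ _.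
have hE c c' : h (c ⊗e c') = c *^r q c' x by apply: tliftE (qt_cop_bal' x) _ _.
have hl : is_lmap (M := C ⊗ C) h.
  split=> // a; apply: tens_ext => [z z'|z z'|c c'].
  - by rewrite /= tens_lD hD.
  - by rewrite hD lactDr.
  - by rewrite /= tens_lE !hE lract.
have rE (m : S) (a : A) : coact (m *^r a) = tens_r (coact m) a.
  by rewrite (rmapr rr).
transitivity ((id ⊗m h) ((id ⊗m (@cop _ _ C)) (coact y))).
  rewrite -(coact_coassoc (bicomP S)).
  move: (coact y); apply: tens_ext => [z z'|z z'|m0 c].
  - by rewrite qt_evalD (rmapD rr).
  - by rewrite tmapD // tassocD tmapD.
  rewrite qt_evalE tmapE // rE.
  move: (coact m0); apply: tens_ext => [z z'|z z'|m1 c1].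
  - by rewrite tens_rD.
  - by rewrite tens_eltDl tassocD tmapD.
  - by rewrite tens_rE tassocE tmapE // hE.
have copl : is_lmap (@cop _ _ C) by case: (cop_bimap (corP C)).
move: (coact y); apply: tens_ext => [z z'|z z'|m c].
- by rewrite !tmapD.
- move: (coact x); apply: tens_ext => [w w'|w w'|x0 x1].
  + by rewrite tmapD //; apply: qt_eval_rmap.
  + rewrite (tmapD (qt_eval_rmap z) (@is_lmap_id _ _ _ C)).
    by rewrite (tmapD (qt_eval_rmap z') (@is_lmap_id _ _ _ C)) addrACA.
  + rewrite (tmapE (qt_eval_rmap z) (@is_lmap_id _ _ _ C)).
    rewrite (tmapE (qt_eval_rmap z') (@is_lmap_id _ _ _ C)).
    rewrite (tmapE (qt_eval_rmap (z + z')) (@is_lmap_id _ _ _ C)).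
    by rewrite qt_evalD tens_eltDl.
rewrite !tmapE // /h qt_cop.
move: (coact x); apply: tens_ext => [w w'|w w'|x0 x1].
- by rewrite (tliftD (qt_cop_bal c)) tens_eltDr.
- by rewrite tmapD //; apply: qt_eval_rmap.
- rewrite (tliftE (qt_cop_bal c)) tmapE //; last exact: qt_eval_rmap.
  by rewrite qt_evalE tens_eltA.
Qed.
End QtildeFacts.

(* p ◊ q *)
Definition pq_lozenge (p : D -> S) (q : Qtilde) (d : D) : cend S :=
  mk_cend (qt_eval_rcomap q (p d)).

Variable pureE : pure_ext E.

(* Sigma as an L-D bicomodule and as a T-D bicomodule. *)
Definition ind_LD : bicom L D := ind_bicom pureE S.
Definition ind_TD : bicom (cend_alg S) D := ind_bicom pureE (eval_bicom S).

Definition weak_cleft : Prop :=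
  exists (j : reg_bicom D -> ind_LD) (jt : Qtilde),
    is_comap j /\ qp_bullet jt j =1 id.

Definition cleft : Prop :=
  exists (j : reg_bicom D -> ind_LD) (jt : Qtilde),
    [/\ is_comap j, qp_bullet jt j =1 id &
        forall d : D, pq_lozenge j jt d = cend_in S (cou d)].

(* T ⊗_L D *)
Definition free_TD : bicom (cend_alg S) D := cend_bimod S ⊗c reg_bicom D.

Definition weak_normal_basis : Prop := iso_direct_summand ind_TD free_TD.

Definition normal_basis : Prop := bicom_iso ind_TD free_TD.

End Cleft.

(* Main.v *)
Require Import Defs.
From mathcomp Require Import all_boot all_algebra.
From HB Require Import structures.
From mathcomp Require Import boolp functions.

Set Implicit Arguments.
Unset Strict Implicit.
Unset Printing Implicit Defensive.

Import GRing.Theory.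
Local Open Scope ring_scope.

(** Let T = End^C(Sigma).  The theorem splits into one statement about maps out
    of and into T ⊗_L D, and one about the canonical maps of the Galois property.

    T ⊗_L D is free on D as a left T-module over L, and cofree on T as a right
    D-comodule.  Hence a bicomodule map T ⊗_L D -> Sigma is f ⊗ d |-> f (j d)
    for a unique left L-linear right D-colinear j : D -> Sigma, and a bicomodule
    map Sigma -> T ⊗_L D is x |-> t (x_[0]) ⊗ x_[1] for a unique T-L bilinear
    t : Sigma -> T.  The weak normal basis property says that some j and t
    satisfy t (x_[0]) (j x_[1]) = x; here idempotents split because the kernel
    of a bicomodule retraction is again a bicomodule.  For the normal basis
    property the other composite has to be the identity too, which means
    t (j d) = eps (d) 1_T.

    Every q in Qtilde yields a T-L bilinear map t_q x = x^[0] q(x^[1])(-), and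
    j ◊ q = t_q \o j.  For each right A-module N there is a map back
      N ⊗_A C -> Hom_A(Sigma, N) ⊗_T Sigma,
      n ⊗ c |-> n q(c_[0])(-) ⊗_T j(c_[1]),
    such that
      can_N after back is N ⊗ (q • j)  (can_map_back),
      back after can_N sends phi ⊗ x to phi ⊗ t_q (x_[0]) (j x_[1])
                                       (can_back_can).
    If q • j = id, the case N = Sigma of the second identity, applied to
    the coaction of x, shows t_q (x_[0]) (j x_[1]) = x, and then both composites
    are identities for all N.  Conversely, if can_A is bijective and
    t_q (x_[0]) (j x_[1]) = x, then A ⊗ (q • j) is the identity
    (qp_bullet_idP).

    What remains is that, for a Galois comodule, every T-L bilinear t is some
    t_q.  Sending phi ⊗ y to phi \o t y and inverting can_N gives a map
    N ⊗_A C -> Hom_A(Sigma, N), natural in N; q is its value for N = A.  The case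
    N = Sigma yields t_q = t (qt_end_of).

    Purity enters through the induced coaction: x_[0] ⊗ x_[1] is determined
    by x_[0]^[0] ⊗ x_[0]^[1] ⊗ x_[1] = x^[0] ⊗ x^[1]_[0] ⊗ x^[1]_[1]. *)

(** * Splitting bicomodule retractions *)

Section Retract.
Variables (k : comPzRingType) (B L : kalg k) (D : coring L) (M X : bicom B D).
Variables (i : M -> X) (p : X -> M).
Hypotheses (iC : is_comap i) (pC : is_comap p) (iK : cancel i p).

Let il : is_lmap i. Proof. by case: iC. Qed.
Let ir : is_rmap i. Proof. by case: iC => _ []. Qed.
Let pl : is_lmap p. Proof. by case: pC. Qed.
Let pr : is_rmap p. Proof. by case: pC => _ []. Qed.

Definition ker_pred : {pred X} := fun x => p x == 0.

Record ker := Ker { ker_val :> X; kerb : ker_val \in ker_pred }.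
HB.instance Definition _ := [isSub for ker_val].
HB.instance Definition _ := [Choice of ker by <:].

Fact ker_zmod_closed : GRing.zmod_closed ker_pred.
Proof.
split=> [|x y]; rewrite !unfold_in; first by rewrite (rmap0 pr).
by move=> /eqP x0 /eqP y0; rewrite (rmapB _ _ pr) x0 y0 subrr.
Qed.
HB.instance Definition _ := GRing.isZmodClosed.Build X ker_pred ker_zmod_closed.
HB.instance Definition _ := [SubChoice_isSubZmodule of ker by <:].

Lemma kerP (z : ker) : p z = 0.
Proof. by case: z => x /= /eqP. Qed.

Definition mk_ker (x : X) (x0 : p x = 0) : ker :=
  Ker (introT eqP x0 : x \in ker_pred).

Lemma ker_inj (z z' : ker) : z = z' :> X -> z = z'.
Proof. exact: val_inj. Qed.

Fact ker_l_subproof b (z : ker) : p (b *^l (z : X)) = 0.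
Proof. by rewrite (lmapl pl) kerP lact0. Qed.

Fact ker_r_subproof (z : ker) a : p ((z : X) *^r a) = 0.
Proof. by rewrite (rmapr pr) kerP ract0. Qed.

Fact ker_bimodP : bimod_axioms (fun b z => mk_ker (ker_l_subproof b z))
  (fun z a => mk_ker (ker_r_subproof z a)).
Proof.
split=> *; apply: ker_inj => /=.
- exact: lactDr.
- exact: lactDl.
- exact: lactA.
- exact: lact1.
- exact: ractDl.
- exact: ractDr.
- exact: ractA.
- exact: ract1.
- exact: lract.
- exact: lract_k.
Qed.

Definition ker_bimod : bimod B L := Bimod ker_bimodP.

Definition ker_inc (z : ker_bimod) : X := z : ker.

Fact ker_proj_subproof (x : X) : p (x - i (p x)) = 0.
Proof. by rewrite (rmapB _ _ pr) iK subrr. Qed.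

Definition ker_proj (x : X) : ker_bimod := mk_ker (ker_proj_subproof x).

Lemma ker_inc_bimap : is_bimap ker_inc.
Proof. by []. Qed.

Lemma ker_proj_bimap : is_bimap ker_proj.
Proof.
have pD x y : ker_proj (x + y) = ker_proj x + ker_proj y.
  apply: ker_inj; rewrite /= (lmapD pl) (lmapD il) opprD.
  by rewrite addrACA.
split; split=> //; [move=> b x | move=> x a]; apply: ker_inj => /=.
  by rewrite (lmapl pl) (lmapl il) lactDr lactN.
by rewrite (rmapr pr) (rmapr ir) ractDl ractN.
Qed.

Lemma ker_incK : cancel ker_inc ker_proj.
Proof.
by move=> z; apply: ker_inj; rewrite /= kerP (rmap0 ir) subr0.
Qed.

Let jr : is_rmap ker_inc. Proof. by case: ker_inc_bimap. Qed.
Let rr : is_rmap ker_proj. Proof. by case: ker_proj_bimap. Qed.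

(** Tensoring with D need not preserve kernels, so the coaction of X is projected
    rather than restricted; the inclusion is colinear because it splits. *)
Definition ker_coact (z : ker_bimod) : ker_bimod ⊗ D :=
  (ker_proj ⊗m id) (coact (ker_inc z)).

Lemma ker_proj_colinear x : ker_coact (ker_proj x) = (ker_proj ⊗m id) (coact x).
Proof.
have [_ cr] := coact_bimap (bicomP X).
have [[_ iE] [_ pE]] := (proj2 iC, proj2 pC).
rewrite /ker_coact /ker_inc /= (rmapB _ _ cr) iE pE.
move: (coact x); apply: (@tens_ext _ _ _ _ X D _
  (fun z => (ker_proj ⊗m id) (z - (i ⊗m id) ((p ⊗m id) z)))) => [y z|y z|y d].
- by rewrite !tmapD // opprD addrACA tmapD.
- by rewrite tmapD.
rewrite !tmapE //.
have -> : y ⊗e d - i (p y) ⊗e d = (y - i (p y)) ⊗e d :> tens_car X D.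
  by apply: (@addIr _ (i (p y) ⊗e d)); rewrite subrK -tens_eltDl subrK.
rewrite tmapE //; congr (_ ⊗e _).
by rewrite -[LHS]/(ker_proj (ker_inc (ker_proj y))) ker_incK.
Qed.

Lemma ker_inc_colinear z : coact (ker_inc z) = (ker_inc ⊗m id) (ker_coact z).
Proof.
have [_ cr] := coact_bimap (bicomP X).
have [[_ iE] [_ pE]] := (proj2 iC, proj2 pC).
(* The inclusion is fixed by the colinear idempotent 1 - i p. *)
have zE : ker_inc z = ker_inc z - i (p (ker_inc z)).
  by rewrite [p _]kerP (rmap0 ir) subr0.
rewrite {1}zE (rmapB _ _ cr) iE pE /ker_coact.
move: (coact (ker_inc z)); apply: (@tens_ext _ _ _ _ X D _
  (fun w => w - (i ⊗m id) ((p ⊗m id) w))) => [y w|y w|y d].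
- by rewrite !tmapD // opprD addrACA.
- by rewrite !tmapD.
rewrite !tmapE //; apply: (@addIr _ (i (p y) ⊗e d)).
by rewrite subrK -tens_eltDl /ker_inc /= subrK.
Qed.

Lemma ker_bicomP : bicom_axioms ker_coact.
Proof.
have [cl cr] := coact_bimap (bicomP X).
have [copl _] := cop_bimap (corP D).
have [jl _] := ker_inc_bimap.
have tl : is_lmap (M := X ⊗ D) (N := ker_bimod ⊗ D) (ker_proj ⊗m id).
  by apply: is_lmap_tmap => //; apply: ker_proj_bimap.
have tr : is_rmap (M := X ⊗ D) (N := ker_bimod ⊗ D) (ker_proj ⊗m id).
  by apply: is_rmap_tmap.
have kr : is_rmap (M := ker_bimod) (N := ker_bimod ⊗ D) ker_coact.
  by split=> *; rewrite /ker_coact ?(rmapD jr) ?(rmapr jr) ?(rmapD cr)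
    ?(rmapr cr) ?(rmapD tr) ?(rmapr tr).
split; first split=> //.
- by split=> *; rewrite /ker_coact ?(lmapD jl) ?(lmapl jl) ?(lmapD cl)
    ?(lmapl cl) ?(lmapD tl) ?(lmapl tl).
- move=> z.
  transitivity ((ker_proj ⊗m id) ((id ⊗m (@cop _ _ D)) (coact (ker_inc z)))).
    rewrite -(coact_coassoc (bicomP X)) [in RHS]ker_inc_colinear.
    move: (ker_coact z); apply: tens_ext => [x y|x y|z' d].
    + by rewrite tmapD // tassocD.
    + by rewrite !tmapD // tassocD tmapD.
    rewrite !tmapE // /ker_coact.
    move: (coact _); apply: tens_ext => [x y|x y|x d'].
    + by rewrite tmapD // tens_eltDl tassocD.
    + by rewrite tens_eltDl tassocD tmapD.
    + by rewrite tmapE // !tassocE tmapE.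
  by rewrite /ker_coact tmap_comp // tmap_comp.
- move=> z; rewrite -[RHS]ker_incK.
  transitivity (ker_proj (ru (coact (ker_inc z)))); first exact: ru_nat.
  by rewrite [ru _](coact_cou (bicomP X)).
Qed.

Definition ker_bicom : bicom B D := Bicom ker_bicomP.

Lemma retract_iso_direct_summand : iso_direct_summand M X.
Proof.
have [jl _] := ker_inc_bimap; have [rl _] := ker_proj_bimap.
exists ker_bicom, i, p, ker_inc, ker_proj.
split; [split | split | split | split | ] => //.
- by split=> //; split=> // z; apply: ker_inc_colinear.
- by split=> //; split=> // x; apply: ker_proj_colinear.
- exact: ker_incK.
- by move=> z; apply: kerP.
- by move=> m; apply: ker_inj; rewrite /= iK subrr.
- by move=> x; rewrite /ker_inc /= addrC subrK.
Qed.
End Retract.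

(** * Cofree comodules X ⊗ D *)

Section CounitBalanced.
Variables (k : comPzRingType) (L : kalg k) (D : coring L).

Lemma counit_lact_bal : balanced (@ract _ _ _ D) (@lact _ _ _ D)
  (fun c d => cou c *^l d).
Proof.
have [[cD _] [_ cr]] := cou_bimap (corP D).
by split=> *; rewrite ?cD ?lactDl ?lactDr // cr lactA.
Qed.
End CounitBalanced.

Section Cofree.
Variables (k : comPzRingType) (B L : kalg k) (D : coring L).
Variables (M : bicom B D) (X : bimod B L).

Definition cofree_map (t : M -> X) (m : M) : X ⊗c reg_bicom D :=
  (t ⊗m id) (coact m).

Lemma cofree_comap t : is_bimap t -> is_comap (cofree_map t).
Proof.
move=> [tl tr]; have [cl cr] := coact_bimap (bicomP M).
have [copl _] := cop_bimap (corP D).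
have ttl : is_lmap (M := M ⊗ D) (N := X ⊗ D) (t ⊗m id) by apply: is_lmap_tmap.
have ttr : is_rmap (M := M ⊗ D) (N := X ⊗ D) (t ⊗m id) by apply: is_rmap_tmap.
split; first by split=> *; rewrite /cofree_map ?(lmapD cl) ?(lmapl cl)
  ?(lmapD ttl) ?(lmapl ttl).
have kr : is_rmap (M := M) (N := X ⊗ D) (cofree_map t).
  by split=> *; rewrite /cofree_map ?(rmapD cr) ?(rmapr cr) ?(rmapD ttr)
    ?(rmapr ttr).
split=> // m.
rewrite -[LHS]/(tassocV ((id ⊗m (@cop _ _ D)) ((t ⊗m id) (coact m)))).
transitivity (tassocV ((t ⊗m id) ((id ⊗m (@cop _ _ D)) (coact m)))).
  by rewrite tmap_comp // tmap_comp.
rewrite -(coact_coassoc (bicomP M)).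
move: (coact m); apply: tens_ext => [x y|x y|m0 d].
- by rewrite tmapD // tassocD tmapD // tassocVD.
- exact: tmapD.
rewrite !tmapE // /cofree_map; move: (coact m0); apply: tens_ext => [x y|x y|m1 d'].
- by rewrite tens_eltDl tassocD tmapD // tassocVD.
- by rewrite tmapD // tens_eltDl.
- by rewrite tassocE !tmapE // tassocVE.
Qed.

(** The coaction of X ⊗ D is comultiplication on the right factor, so X ⊗ eps
    applied to its first two factors is the identity; colinearity of f turns
    this into the formula for f. *)
Lemma comap_cofree (f : M -> X ⊗c reg_bicom D) : is_comap f ->
  is_bimap (fun m => ru (f m)) /\ f =1 cofree_map (fun m => ru (f m)).
Proof.
move=> [fl [fr fE]]; have [rl rr] := ru_bimap D X.
have [copl copr] := cop_bimap (corP D).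
have tr : is_rmap (fun m => ru (f m)).
  by split=> *; rewrite ?(rmapD fr) ?(rmapr fr) ?(rmapD rr) ?(rmapr rr).
split; first split=> //.
  by split=> *; rewrite ?(lmapD fl) ?(lmapl fl) ?(lmapD rl) ?(lmapl rl).
move=> m; transitivity ((@ru _ _ _ D X ⊗m id) (coact (f m))); last first.
  by rewrite fE tmap_comp.
rewrite -[coact _]/(tassocV ((id ⊗m (@cop _ _ D)) (f m))).
move: (f m); apply: (@tens_ext _ _ _ _ X D _ id) => [//|x y|x d].
  by rewrite tmapD // tassocVD tmapD.
rewrite tmapE // -{1}(cop_coul (corP D) d).
have lb := counit_lact_bal D.
move: (cop d); apply: tens_ext => [y z|y z|c e].
- by rewrite (tliftD lb) tens_eltDr.
- by rewrite tens_eltDr tassocVD tmapD.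
- by rewrite (tliftE lb) tassocVE tmapE // ruE tens_eltA.
Qed.
End Cofree.

(** * The induced D-coaction and the free bicomodule T ⊗ D *)

Section Induction.
Variables (k : comPzRingType) (A L : kalg k) (C : coring A) (D : coring L).
Variables (E : right_ext C D) (pureE : pure_ext E).

(** The induced coaction is only known through its image under the injective
    map rho ⊗ D, so colinearity is checked there. *)
Lemma ind_rcomap (B B' : kalg k) (M : bicom B C) (N : bicom B' C) (f : M -> N) :
  is_rcomap f -> is_rcomap (M := ind_bicom pureE M) (N := ind_bicom pureE N) f.
Proof.
move=> [fr fE]; have [_ rM] := coact_ind_bimap E M.
have [_ rN] := coact_ind_bimap E N.
have fr' : is_rmap (M := M ⊗ ext_bimod E) (N := N ⊗ ext_bimod E) (f ⊗m id).
  by apply: is_rmap_tmap.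
have fi : is_rmap (M := ind_bimod E M) (N := ind_bimod E N) f.
  split=> [x y|x l]; first exact: (rmapD fr).
  apply: (@coact_inj _ _ _ _ N); rewrite fE [in RHS]coact_ind fE.
  exact: etrans (congr1 _ (rmapr rM x l)) (rmapr fr' _ _).
split=> // m; apply: (rhoD_inj pureE (M := N)); rewrite [LHS]ind_coactP.
transitivity (tens_coact (N := ext_bicom E) ((f ⊗m id) (coact (b := M) m))).
  by rewrite /coactCD fE.
rewrite (tens_coact_nat (N := ext_bicom E)) //.
rewrite -[tens_coact _]/(coactCD E m) -(ind_coactP pureE) /rhoD.
rewrite tmap_comp // [RHS]tmap_comp //.
by congr (tmap _ _ _); apply/funext => x /=; rewrite fE.
Qed.

Variable S : bicom L C.

(** The induced coaction is picked by a choice operator, so that its independence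
    of the left action is not definitional. *)
Lemma ind_coact_eval (x : S) :
  ind_coact pureE (M := eval_bicom S) x = ind_coact pureE (M := S) x.
Proof.
have idS : is_rcomap (M := S) (N := eval_bicom S) id.
  by split=> // m; symmetry; apply: (tmap_id (M := S) (N := C)).
have [_ e] := ind_rcomap idS; apply: etrans (e x) _.
exact: (tmap_id (M := ind_bimod E S) (N := D)).
Qed.

Definition free_map (j : D -> S) (z : cend_bimod S ⊗ D) : S :=
  \tsum_(f, d <- z) (f : cend S) (j d).

Section Free.
Variable j : D -> S.
Hypothesis jL : is_lmap (M := D) (N := S) j.

Lemma free_bal : balanced (@ract _ _ _ (cend_bimod S)) (@lact _ _ _ D)
  (fun (f : cend S) d => f (j d)).
Proof.
split=> [//|f d d'|f l d]; last by rewrite (lmapl jL).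
by rewrite (lmapD jL) (rmapD (rcomap_rmap (cendP f))).
Qed.

Lemma free_mapD x y : free_map j (x + y) = free_map j x + free_map j y.
Proof. exact: tliftD free_bal _ _. Qed.

Lemma free_mapE f d :
  free_map j ((f : cend_bimod S) ⊗e d) = (f : cend S) (j d).
Proof. exact: tliftE free_bal _ _. Qed.
End Free.

Lemma free_comap (j : D -> S) :
  is_comap (M := reg_bicom D) (N := ind_LD S pureE) j ->
  is_comap (M := free_TD D S) (N := ind_TD S pureE) (free_map j).
Proof.
move=> [jl [jr jE]].
have jL : is_lmap (M := D) (N := S) j by case: jl; split.
have cendL (f : cend S) : is_rcomap (M := ind_LD S pureE) (N := ind_LD S pureE) f.
  exact/ind_rcomap/cendP.
have freeR0 x l : free_map j (x *^r l) = (free_map j x : ind_TD S pureE) *^r l.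
  move: x; apply: tens_ext => [x y|x y|f d].
  - by rewrite ractDl free_mapD.
  - by rewrite free_mapD // ractDl.
  - rewrite [_ *^r _]tens_rE !free_mapE // (rmapr jr).
    by rewrite (rmapr (rcomap_rmap (cendL f))).
split; first split; try exact: free_mapD.
  move=> t; apply: tens_ext => [x y|x y|f d].
  + by rewrite lactDr free_mapD.
  + by rewrite free_mapD // lactDr.
  + by rewrite [_ *^l _]tens_lE !free_mapE.
split; first by split; [exact: free_mapD | exact: freeR0].
have freeR : is_rmap (M := cend_bimod S ⊗ D) (N := ind_bimod E (eval_bicom S))
    (free_map j) by split; [exact: free_mapD | exact: freeR0].
apply: tens_ext => [x y|x y|f d].
- by rewrite free_mapD // (rmapD (proj2 (coact_bimap (bicomP (ind_TD S pureE))))).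
- rewrite (rmapD (proj2 (coact_bimap (bicomP (free_TD D S))))).
  exact: (tmapD freeR).
have [_ jE'] : is_rcomap (M := ind_LD S pureE) (N := ind_LD S pureE) f := cendL f.
have fr := rcomap_rmap (cendL f).
rewrite free_mapE // [LHS]ind_coact_eval [LHS]jE' jE.
rewrite [X in _ = (_ ⊗m _) X](tens_coactE (N := reg_bicom D)).
rewrite -[coact (b := reg_bicom D) d]/(cop d).
move: (cop d); apply: tens_ext => [x y|x y|d1 d2].
- by rewrite !tmapD.
- by rewrite tens_eltDr tassocVD (tmapD freeR).
- by rewrite tassocVE !tmapE // free_mapE.
Qed.

Definition unit_map (f : cend_bimod S ⊗ D -> S) (d : D) : S :=
  f (((1 : cend_alg S) : cend_bimod S) ⊗e d).

(** T ⊗ D is generated over T by the elements 1 ⊗ d, and the L-linearity of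
    d |-> f (1 ⊗ d) comes from 1 ⊗ l d = l (1 ⊗ d) in T ⊗_L D. *)
Lemma comap_free (f : free_TD D S -> ind_TD S pureE) : is_comap f ->
  is_comap (M := reg_bicom D) (N := ind_LD S pureE)
    (unit_map f) /\ f =1 free_map (unit_map f).
Proof.
move=> [fl [fr fE]].
pose j : D -> S := unit_map f.
have jl : is_lmap (M := D) (N := S) j.
  split=> [d d'|l d]; first by rewrite /j /unit_map tens_eltDr (rmapD fr).
  rewrite /j /unit_map -tens_eltA.
  have -> : (((1 : cend_alg S) : cend_bimod S) *^r l) ⊗e d =
      (cend_in S l : cend_alg S) *^l (((1 : cend_alg S) : cend_bimod S) ⊗e d)
      :> cend_bimod S ⊗ D.
    rewrite [RHS]tens_lE; congr (_ ⊗e _).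
    by rewrite -[LHS]/(1 * cend_in S l) mul1r -[RHS]/(cend_in S l * 1) mulr1.
  by rewrite [LHS](lmapl fl).
split; last first.
  apply: tens_ext => [x y|x y|t d]; first exact: (rmapD fr).
    exact: free_mapD.
  rewrite free_mapE // -[RHS]/(t *^l (j d : ind_TD S pureE)) -[RHS](lmapl fl).
  congr f; rewrite [RHS]tens_lE; congr (_ ⊗e _).
  by rewrite -[RHS]/(t * 1) mulr1.
split; first by case: jl; split.
split.
  split=> [d d'|d l]; first by rewrite /unit_map tens_eltDr (rmapD fr).
  by rewrite /unit_map -[RHS](rmapr fr); congr f; rewrite [RHS]tens_rE.
move=> d; rewrite -[LHS]ind_coact_eval [LHS]fE.
rewrite [coact _](tens_coactE (N := reg_bicom D)).
rewrite -[coact (b := reg_bicom D) d]/(cop d).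
have jR : is_rmap (M := D) (N := ind_bimod E S) j.
  split=> [d1 d2|d1 l]; first by rewrite /j /unit_map tens_eltDr (rmapD fr).
  by rewrite /j /unit_map -[RHS](rmapr fr); congr f; rewrite [RHS]tens_rE.
move: (cop d); apply: tens_ext => [x y|x y|d1 d2].
- by rewrite tens_eltDr tassocVD tmapD.
- exact: (tmapD jR).
- by rewrite tassocVE tmapE // (tmapE jR).
Qed.
End Induction.

(** * The map n ⊗ c |-> n q(c_[0])(-) ⊗ j(c_[1]) against the canonical map *)

Section QtildeHom.
Variables (k : comPzRingType) (A L : kalg k) (C : coring A) (D : coring L).
Variables (E : right_ext C D) (S : bicom L C) (q : Qtilde E S).

Lemma qtD c c' x : q (c + c') x = q c x + q c' x.
Proof. by rewrite (lmapD (proj1 (qt_bimap q))). Qed.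
Lemma qtl a c x : q (a *^l c) x = a * q c x.
Proof. by rewrite (lmapl (proj1 (qt_bimap q))). Qed.
Lemma qtDr c x y : q c (x + y) = q c x + q c y.
Proof. exact: rmapD (rhomP (q c)) _ _. Qed.
Lemma qtr c x a : q c (x *^r a) = q c x * a.
Proof. exact: rmapr (rhomP (q c)) _ _. Qed.
Lemma qtL c l x : q (ext_ract E c l) x = q c (l *^l x).
Proof. by rewrite (rmapr (proj2 (qt_bimap q)) c l). Qed.

Section QtHom.
Variable N : bimod (base_alg k) A.

Lemma qt_hom_bal x : balanced (@ract _ _ _ N) (@lact _ _ _ C)
  (fun n c => n *^r q c x).
Proof. by split=> *; rewrite ?ractDl ?qtD ?ractDr ?qtl ?ractA. Qed.

(** For N = Sigma, the coaction of y goes to the endomorphism t_q y. *)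
Definition qt_hom_fun (w : N ⊗ C) (x : S) : N := \tsum_(n, c <- w) (n *^r q c x).

Lemma qt_hom_funD w w' x : qt_hom_fun (w + w') x = qt_hom_fun w x + qt_hom_fun w' x.
Proof. exact: tliftD (qt_hom_bal x) _ _. Qed.

Lemma qt_hom_funE n c x : qt_hom_fun (n ⊗e c) x = n *^r q c x.
Proof. exact: tliftE (qt_hom_bal x) _ _. Qed.

Fact qt_hom_rmap w : is_rmap (M := eval_bicom S) (N := N) (qt_hom_fun w).
Proof.
split=> [x y|x a]; move: w; apply: tens_ext => [w w'|w w'|n c].
- exact: qt_hom_funD.
- by rewrite !qt_hom_funD addrACA.
- by rewrite !qt_hom_funE qtDr ractDr.
- exact: qt_hom_funD.
- by rewrite qt_hom_funD ractDl.
- by rewrite !qt_hom_funE qtr ractA.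
Qed.

Definition qt_hom (w : N ⊗ C) : rhom_bimod (eval_bicom S) N :=
  mk_rhom (qt_hom_rmap w).

Lemma qt_homD w w' : qt_hom (w + w') = qt_hom w + qt_hom w'.
Proof. by apply: rhom_inj => x; apply: qt_hom_funD. Qed.

Lemma qt_homL (w : N ⊗ ext_bimod E) (l : L) :
  qt_hom (w *^r l) = qt_hom w *^r (cend_in S l : cend_alg S).
Proof.
apply: rhom_inj => x; rewrite -[RHS]/(qt_hom_fun w (l *^l x)).
move: w; apply: tens_ext => [w w'|w w'|n c].
- by rewrite [_ *^r l]tens_rD [LHS]qt_hom_funD.
- exact: qt_hom_funD.
- by rewrite [_ *^r l]tens_rE [LHS]qt_hom_funE qtL qt_hom_funE.
Qed.
End QtHom.

Definition qt_end (y : S) : cend S := mk_cend (qt_eval_rcomap q y).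

Lemma qt_end_bimap :
  is_bimap (M := ind_bimod E (eval_bicom S)) (N := cend_bimod S) qt_end.
Proof.
have [_ cr] := coact_bimap (bicomP S).
have eD (x y : S) : qt_end (x + y) = qt_end x + qt_end y.
  by apply: cend_inj => z; rewrite /= (rmapD cr) qt_evalD.
split; split=> //; [move=> t y | move=> y l]; apply: cend_inj => z.
- have [tr tE] := cendP t; rewrite /= tE.
  move: (coact y); apply: tens_ext => [w w'|w w'|n c].
  + by rewrite tmapD // qt_evalD.
  + by rewrite qt_evalD (rmapD tr).
  + by rewrite tmapE // !qt_evalE (rmapr tr).
- rewrite -[RHS]/(qt_eval q (coact y) (l *^l z)).
  rewrite -[LHS]/(qt_eval q (coact (ind_ract E y l)) z) coact_ind.
  move: (coact y); apply: tens_ext => [w w'|w w'|n c].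
  + by rewrite tens_rD qt_evalD.
  + exact: qt_evalD.
  + by rewrite tens_rE !qt_evalE qtL.
Qed.

Variable j : D -> S.
Hypothesis jL : is_lmap (M := D) (N := S) j.

(** The map C ⊗_L D -> C whose composite with the D-coaction of C is q • j. *)
Definition bullet_lift (z : ext_bimod E ⊗ D) : C :=
  \tsum_(c, d <- z) \tsum_(x0, x1 <- coact (j d)) (q c x0 *^l x1).

Lemma bullet_liftD z z' : bullet_lift (z + z') = bullet_lift z + bullet_lift z'.
Proof. exact: tliftD (qp_bullet_bal q jL) _ _. Qed.

Lemma bullet_liftE c d :
  bullet_lift (c ⊗e d) = \tsum_(x0, x1 <- coact (j d)) (q c x0 *^l x1).
Proof. exact: tliftE (qp_bullet_bal q jL) _ _. Qed.

Lemma bullet_lift_lmap : is_lmap (M := ext_bimod E ⊗ D) (N := C) bullet_lift.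
Proof.
split=> [|a]; first exact: bullet_liftD.
apply: tens_ext => [x y|x y|c d].
- by rewrite lactDr bullet_liftD.
- by rewrite bullet_liftD lactDr.
rewrite [a *^l _]tens_lE !bullet_liftE.
move: (coact (j d)); apply: tens_ext => [x y|x y|x0 x1].
- exact: (tliftD (qt_cop_bal q _)).
- by rewrite (tliftD (qt_cop_bal q _)) lactDr.
- by rewrite !(tliftE (qt_cop_bal q _)) qtl lactA.
Qed.

Lemma qp_bullet_lmap : is_lmap (M := C) (N := C) (qp_bullet q j).
Proof.
have [[tD tl] _] := coact_bimap (bicomP (ext_bicom E)).
have [bD bl] := bullet_lift_lmap.
split=> [c c'|a c]; first by rewrite -[RHS]bD -tD.
by rewrite -[RHS]bl -tl.
Qed.

Section CanBack.
Variable N : bimod (base_alg k) A.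

Lemma can_back_bal : balanced (@ract _ _ _ (N ⊗ ext_bimod E)) (@lact _ _ _ D)
  (fun w d => qt_hom (N := N) w ⊗e (j d : eval_bicom S)).
Proof.
split=> [w w' d|w d d'|w l d].
- by rewrite qt_homD tens_eltDl.
- by rewrite (lmapD jL) tens_eltDr.
- by rewrite qt_homL tens_eltA (lmapl jL).
Qed.

Definition can_back (z : N ⊗ C) : rhom_bimod (eval_bicom S) N ⊗ eval_bicom S :=
  \tsum_(w, d <- coact (b := N ⊗c ext_bicom E) z) (qt_hom w ⊗e (j d : eval_bicom S)).

Lemma can_mapD z z' : can_map (N := N) (z + z') = can_map z + can_map (S := S) z'.
Proof. exact: tliftD (can_elt_bal S N) _ _. Qed.

Lemma can_mapE (phi : rhom_bimod (eval_bicom S) N) x :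
  can_map (phi ⊗e (x : eval_bicom S)) = can_elt phi x.
Proof. exact: tliftE (can_elt_bal S N) _ _. Qed.

Lemma rhom_eval_rmap (phi : rhom_bimod (eval_bicom S) N) :
  is_rmap (M := S) (N := N) phi.
Proof. by case: (rhomP phi); split. Qed.

Lemma can_eltE (phi : rhom_bimod (eval_bicom S) N) (x : S) :
  can_elt phi x = tmap (M := S) (M' := N) phi id (coact (b := S) x).
Proof. by []. Qed.

Lemma can_backD z z' : can_back (z + z') = can_back z + can_back z'.
Proof.
have [_ cr] := coact_bimap (bicomP (N ⊗c ext_bicom E)).
by rewrite /can_back (rmapD cr) (tliftD can_back_bal).
Qed.

(** On n ⊗ c both sides read n ⊗ q(c_[0])(j(c_[1])^[0]) j(c_[1])^[1]. *)
Lemma can_map_back z : can_map (can_back z) = (id ⊗m qp_bullet q j) z.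
Proof.
have bl := qp_bullet_lmap.
move: z; apply: tens_ext => [x y|x y|n c].
- by rewrite can_backD can_mapD.
- by rewrite tmapD.
rewrite tmapE // /can_back [coact _](tens_coactE (N := ext_bicom E)).
rewrite -[qp_bullet q j c]/(bullet_lift (coact (b := ext_bicom E) c)).
move: (coact (b := ext_bicom E) c); apply: tens_ext => [x y|x y|c0 d].
- by rewrite tens_eltDr tassocVD (tliftD can_back_bal) can_mapD.
- by rewrite bullet_liftD tens_eltDr.
rewrite tassocVE (tliftE can_back_bal) can_mapE bullet_liftE can_eltE.
have hr := rhom_eval_rmap (qt_hom (N := N) (n ⊗e c0)).
move: (coact (j d)); apply: tens_ext => [x y|x y|x0 x1].
- exact: (tmapD hr (@is_lmap_id _ _ _ C)).
- by rewrite (tliftD (qt_cop_bal q _)) tens_eltDr.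
rewrite [LHS](tmapE hr) // (tliftE (qt_cop_bal q _)).
by rewrite -[qt_hom _ _]/(qt_hom_fun _ _) qt_hom_funE tens_eltA.
Qed.

Variable pureE : pure_ext E.

(** The defining property of the induced coaction replaces
    y^[0] ⊗ y^[1]_[0] ⊗ y^[1]_[1] by y_[0]^[0] ⊗ y_[0]^[1] ⊗ y_[1], so that the
    first tensor factor becomes phi \o t_q (y_[0]); then t_q (y_[0]) moves across
    the tensor product over T. *)
Lemma can_back_can (phi : rhom_bimod (eval_bicom S) N) (y : S) :
  can_back (can_elt phi y) =
  phi ⊗e (free_map j (cofree_map (M := ind_TD S pureE) (X := cend_bimod S)
                        qt_end y) : eval_bicom S).
Proof.
have phiR := rhomP phi; have phir := rhom_eval_rmap phi.
rewrite /can_back.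
transitivity (\tsum_(w, d <- tmap (M := S ⊗ ext_bimod E) (M' := N ⊗ ext_bimod E)
  (phi ⊗m id) id
  (coactCD E (M := S) y)) (qt_hom (N := N) w ⊗e (j d : eval_bicom S))).
  congr tlift; rewrite -[coactCD E y]/(tens_coact (N := ext_bicom E) (coact y)).
  by rewrite -(tens_coact_nat (N := ext_bicom E)).
rewrite -(ind_coactP pureE) -ind_coact_eval /cofree_map.
rewrite -[coact (b := ind_TD S pureE) y]/(ind_coact pureE (M := eval_bicom S) y).
move: (ind_coact _ _).
have [_ tr] := qt_end_bimap.
have fi : is_rmap (M := S ⊗ ext_bimod E) (N := N ⊗ ext_bimod E) (phi ⊗m id).
  by apply: is_rmap_tmap.
have [_ rr] := rhoD_bimap E S.
have [_ rM] := coact_ind_bimap E S.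
apply: tens_ext => [x z|x z|x d].
- by rewrite (rmapD rr) (tmapD fi) // (tliftD can_back_bal).
- by rewrite (tmapD tr) // free_mapD // tens_eltDr.
rewrite (tmapE tr) // free_mapE // /rhoD tmapE // tmapE //.
transitivity ((phi *^r (qt_end x : cend_alg S)) ⊗e (j d : eval_bicom S));
  last exact: tens_eltA.
rewrite (tliftE can_back_bal); congr (_ ⊗e _).
apply: rhom_inj => z; rewrite -[LHS]/(qt_hom_fun _ _).
rewrite -[RHS]/(phi (qt_eval q (coact (b := S) x) z)).
move: (coact (b := S) x); apply: tens_ext => [u v|u v|x0 x1].
- by rewrite tmapD // qt_hom_funD.
- by rewrite qt_evalD (rmapD phir).
- by rewrite tmapE // qt_hom_funE qt_evalE (rmapr phir).
Qed.
End CanBack.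
End QtildeHom.

(** * Galois comodules and q • j = id *)

Section Galois.
Variables (k : comPzRingType) (A L : kalg k) (C : coring A) (D : coring L).
Variables (E : right_ext C D) (S : bicom L C).

Lemma is_rmap_idS : is_rmap (M := eval_bicom S) (N := res_bimod S) id.
Proof. by []. Qed.

Definition id_rhom : rhom_bimod (eval_bicom S) (res_bimod S) :=
  mk_rhom is_rmap_idS.

Lemma can_elt_id (y : S) : can_elt id_rhom y = coact y.
Proof. exact: (tmap_id (M := S) (N := C)). Qed.

Lemma reg_act_bal : balanced (@ract _ _ _ (res_bimod (reg_bimod A)))
  (@lact _ _ _ C) (fun (a : A) c => a *^l c).
Proof. by split=> *; rewrite ?lactDl ?lactDr ?lactA. Qed.

Section BulletId.
Variables (pureE : pure_ext E) (q : Qtilde E S) (j : D -> S).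
Hypothesis jL : is_lmap (M := D) (N := S) j.
Let cofree : S -> cend_bimod S ⊗ D :=
  cofree_map (M := ind_TD S pureE) (X := cend_bimod S) (qt_end q).

Lemma can_backK (N : bimod (base_alg k) A) :
  cancel cofree (free_map j) ->
  cancel (@can_map _ _ _ _ S N) (can_back q j (N := N)).
Proof.
move=> fK; apply: tens_ext => [x y|//|phi y].
  by rewrite can_mapD can_backD.
rewrite can_mapE (can_back_can q jL pureE) -[free_map _ _]/(free_map j (cofree y)).
by rewrite fK.
Qed.

(** From q • j = id, the identity in Sigma is read off at N = Sigma.  Conversely,
    q • j is read off at N = A, where the map back is a left inverse of the
    bijection can_A and therefore a right inverse too. *)
Lemma qp_bullet_idP : qp_bullet q j =1 id <->
  galois_comodule S /\ cancel cofree (free_map j).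
Proof.
split=> [qj|[G fK] c].
  have canK (N : bimod (base_alg k) A) :
      cancel (can_back q j (N := N)) (@can_map _ _ _ _ S N).
    move=> z; rewrite can_map_back //.
    have -> : qp_bullet q j = id by apply/funext.
    exact: tmap_id.
  have fK : cancel cofree (free_map j).
    (* The coaction of y is can (id ⊗ y) for N = S, and it determines y. *)
    move=> y; apply: (@coact_inj _ _ _ _ S).
    rewrite -!can_elt_id -[RHS]canK.
    by rewrite (can_back_can q jL pureE id_rhom y) can_mapE.
  by split=> // N; exists (can_back q j (N := N)); [exact: can_backK | exact: canK].
pose R := res_bimod (reg_bimod A).
have [g _ Kg] := G R.
have e (z : R ⊗ C) : (id ⊗m qp_bullet q j) z = z.
  by rewrite -can_map_back // -(Kg z) can_backK.
have := congr1 (tlift (fun (a : A) (c : C) => a *^l c)) (e (((1 : A) : R) ⊗e c)).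
rewrite tmapE //; last exact: qp_bullet_lmap.
by rewrite !(tliftE reg_act_bal) !lact1.
Qed.
End BulletId.

(** * Recovering q from a bilinear map Sigma -> T *)

Hypothesis G : galois_comodule S.

(** Surjectivity of can makes the elements phi(y^[0]) ⊗ y^[1] generators. *)
Lemma galois_ext (N : bimod (base_alg k) A) (V : zmodType) (f g : N ⊗ C -> V) :
  {morph f : x y / x + y} -> {morph g : x y / x + y} ->
  (forall phi y, f (can_elt (S := S) phi y) = g (can_elt phi y)) -> f =1 g.
Proof.
move=> fD gD fg z; have [h _ Kh] := G N; rewrite -(Kh z).
move: (h z); apply: (@tens_ext _ _ _ _ _ _ _ (f \o @can_map _ _ _ _ S N)
  (g \o @can_map _ _ _ _ S N)) => [x y|x y|phi y] /=.
- by rewrite can_mapD fD.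
- by rewrite can_mapD gD.
- by rewrite can_mapE.
Qed.

Variable t : S -> cend S.
Hypothesis tB : is_bimap (M := ind_bimod E (eval_bicom S)) (N := cend_bimod S) t.

Lemma end_mapD x y : t (x + y) = t x + t y.
Proof. exact: (rmapD (proj2 tB)). Qed.
Lemma end_mapT (f : cend S) x : t (f x) = f * t x.
Proof. exact: (lmapl (proj1 tB) f x). Qed.
Lemma end_mapL x l : t (ind_ract E x l) = t x * cend_in S l.
Proof. exact: (rmapr (proj2 tB) x l). Qed.

Lemma can_hom_ex (N : bimod (base_alg k) A) : exists F : N ⊗ C -> S -> N,
  (forall z z' x, F (z + z') x = F z x + F z' x) /\
  forall (phi : rhom_bimod (eval_bicom S) N) y x, F (can_elt phi y) x = phi (t y x).
Proof.
have [h hK Kh] := G N.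
have hD z z' : h (z + z') = h z + h z'.
  by apply: (can_inj hK); rewrite can_mapD !Kh.
have eB x : balanced (@ract _ _ _ (rhom_bimod (eval_bicom S) N))
    (@lact _ _ _ (eval_bicom S)) (fun phi y => (phi : rhom _ _) (t y x)).
  split=> [//|phi y z|phi f y].
  - by rewrite end_mapD; apply: (rmapD (rhomP phi)).
  - by rewrite -[f *^l y]/(f y) end_mapT.
exists (fun z x => tlift
  (fun (phi : rhom_bimod (eval_bicom S) N) (y : eval_bicom S) => phi (t y x)) (h z)).
split.
- by move=> z z' x; rewrite hD (tliftD (eB x)).
- by move=> phi y x; rewrite -can_mapE hK (tliftE (eB x)).
Qed.

(** N ⊗ C -> Hom_A(Sigma, N), sending phi(y^[0]) ⊗ y^[1] to phi \o t y. *)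
Definition can_hom (N : bimod (base_alg k) A) : N ⊗ C -> S -> N :=
  projT1 (cid (can_hom_ex N)).

Section CanHom.
Variable N : bimod (base_alg k) A.

Lemma can_homD z z' x : can_hom (N := N) (z + z') x = can_hom z x + can_hom z' x.
Proof. by rewrite /can_hom; case: cid => F [/= FD _]; apply: FD. Qed.

Lemma can_hom_can (phi : rhom_bimod (eval_bicom S) N) y x :
  can_hom (can_elt phi y) x = phi (t y x).
Proof. by rewrite /can_hom; case: cid => F [/= _ FE]; apply: FE. Qed.

Lemma can_hom_rmap z : is_rmap (M := S) (N := N) (can_hom z).
Proof.
split=> [x y|x a]; move: z; apply: galois_ext => [z z'|z z'|phi y0].
- exact: can_homD.
- by rewrite !can_homD addrACA.
- have tr := rcomap_rmap (cendP (t y0)).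
  by rewrite !can_hom_can (rmapD tr) (rmapD (rhomP phi)).
- exact: can_homD.
- by rewrite can_homD ractDl.
- have tr := rcomap_rmap (cendP (t y0)).
  by rewrite !can_hom_can (rmapr tr) (rmapr (rhomP phi)).
Qed.

(** t is right L-linear and y l has coaction y^[0] ⊗ y^[1] l. *)
Lemma can_homL (z : N ⊗ ext_bimod E) l x :
  can_hom (N := N) (z *^r l) x = can_hom (N := N) z (l *^l x).
Proof.
move: z; apply: galois_ext => [z z'|z z'|phi y].
- by rewrite -can_homD; congr can_hom; apply: (@tens_rD _ _ _ _ N (ext_bimod E)).
- exact: can_homD.
rewrite can_hom_can.
transitivity (can_hom (can_elt phi (ind_ract E (y : S) l)) x); last first.
  by rewrite can_hom_can end_mapL.
congr can_hom; rewrite !can_eltE coact_ind.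
have phir := rhom_eval_rmap phi.
move: (coact (b := S) y); apply: tens_ext => [u v|u v|x0 x1].
- by rewrite tmapD //; apply: (@tens_rD _ _ _ _ N (ext_bimod E)).
- by rewrite tens_rD tmapD.
- by rewrite tmapE // tens_rE tmapE // [LHS](@tens_rE _ _ _ _ N (ext_bimod E)).
Qed.
End CanHom.

Lemma can_hom_nat (N N' : bimod (base_alg k) A) (f : N -> N') z x :
  is_rmap f -> can_hom (N := N') ((f ⊗m id) z) x = f (can_hom z x).
Proof.
move=> fr; move: z; apply: galois_ext => [z z'|z z'|phi y].
- by rewrite tmapD // can_homD.
- by rewrite can_homD (rmapD fr).
have phir := rhom_eval_rmap phi.
have fphir : is_rmap (M := eval_bicom S) (N := N') (f \o phi).
  by split=> *; rewrite /= ?(rmapD phir) ?(rmapr phir) ?(rmapD fr) ?(rmapr fr).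
pose fphi : rhom_bimod (eval_bicom S) N' := mk_rhom fphir.
rewrite can_hom_can -[RHS](can_hom_can fphi); congr can_hom.
by rewrite !can_eltE tmap_comp.
Qed.

Let R := res_bimod (reg_bimod A).

Definition qt_of_fun (c : C) (x : S) : A := can_hom (((1 : A) : R) ⊗e c) x.

(** Naturality along a |-> n a reduces every N to N = A. *)
Lemma can_homE (N : bimod (base_alg k) A) (n : N) c x :
  can_hom (n ⊗e c) x = n *^r qt_of_fun c x.
Proof.
have nr : is_rmap (M := R) (N := N) (fun a => n *^r (a : A)).
  by split=> *; [exact: ractDr | exact: ractA].
by rewrite -(can_hom_nat (N' := N) _ _ nr) tmapE // ract1.
Qed.

Fact qt_of_rmap c : is_rmap (M := S) (N := reg_bimod A) (qt_of_fun c).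
Proof.
by case: (can_hom_rmap (((1 : A) : R) ⊗e c)); split.
Qed.

Definition qt_of_hom (c : ext_bimod E) : dual_bimod S := mk_rhom (qt_of_rmap c).

Fact qt_of_bimap : is_bimap qt_of_hom.
Proof.
have qD c c' : qt_of_hom (c + c') = qt_of_hom c + qt_of_hom c'.
  by apply: rhom_inj => x; rewrite /= /qt_of_fun tens_eltDr can_homD.
split; split=> //; [move=> a c | move=> c l]; apply: rhom_inj => x.
- rewrite -[RHS](can_homE (N := R) (a : A) c x) -[LHS]/(qt_of_fun (a *^l c) x).
  by rewrite /qt_of_fun -tens_eltA -[_ *^r a]/(1 * a) mul1r.
- rewrite -[RHS]/(qt_of_fun c (l *^l x)) -[LHS]/(qt_of_fun (c *^r l) x).
  pose u : R ⊗ ext_bimod E := ((1 : A) : R) ⊗e c.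
  transitivity (can_hom (N := R) (u *^r l) x); last exact: (@can_homL R u l x).
  by rewrite /qt_of_fun -[u *^r l]/(tens_r u l) tens_rE.
Qed.

(** For c = phi(y^[0]) y^[1], coassociativity turns c^(1) q(c^(2))(x) into
    phi ⊗ C applied to the coaction of y^[0] q(y^[1])(x) = t y x; as t y is
    colinear this is phi(t y x^[0]) x^[1] = q(c)(x^[0]) x^[1]. The identity is
    proved in N ⊗ C for all N, so that generators can be used, and then read
    off in A ⊗ C = C. *)
Fact qt_of_cop (c : C) (x : S) :
  \tsum_(c1, c2 <- cop c) (c1 *^r qt_of_hom c2 x) =
  \tsum_(x0, x1 <- coact x) (qt_of_hom c x0 *^l x1).
Proof.
have [qD0 ql0] := proj1 qt_of_bimap.
have qD c1 c2 : qt_of_fun (c1 + c2) x = qt_of_fun c1 x + qt_of_fun c2 x.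
  exact: (congr1 (fun f : dual_bimod S => f x) (qD0 c1 c2)).
have ql a c1 : qt_of_fun (a *^l c1) x = a * qt_of_fun c1 x.
  exact: (congr1 (fun f : dual_bimod S => f x) (ql0 a c1)).
have hB : balanced (@ract _ _ _ C) (@lact _ _ _ C) (fun c1 c2 => c1 *^r qt_of_fun c2 x).
  by split=> *; rewrite ?ractDl ?qD ?ractDr ?ql ?ractA.
pose h (z : C ⊗ C) : C := \tsum_(c1, c2 <- z) (c1 *^r qt_of_fun c2 x).
have hD z z' : h (z + z') = h z + h z' by apply: tliftD hB _ _.
have hE c1 c2 : h (c1 ⊗e c2) = c1 *^r qt_of_fun c2 x by apply: tliftE hB _ _.
have hl : is_lmap (M := C ⊗ C) h.
  split=> // a; apply: tens_ext => [z z'|z z'|c1 c2].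
  - by rewrite /= tens_lD hD.
  - by rewrite hD lactDr.
  - by rewrite /= tens_lE !hE lract.
have [copl _] := cop_bimap (corP C).
have hcl : is_lmap (M := C) (N := C) (h \o @cop _ _ C).
  by split=> *; rewrite /= ?(lmapD copl) ?(lmapl copl) ?hD ?(lmapl hl).
have [_ cr] := coact_bimap (bicomP S).
have key (N : bimod (base_alg k) A) (z : N ⊗ C) :
    (id ⊗m h) ((id ⊗m (@cop _ _ C)) z) =
    tmap (M := S) (M' := N) (can_hom z) id (coact x).
  move: z; apply: galois_ext => [z z'|z z'|phi y].
  - by rewrite !tmapD.
  - move: (coact x); apply: tens_ext => [w w'|w w'|x0 x1].
    + by rewrite (tmapD (can_hom_rmap _)).
    + by rewrite !(tmapD (can_hom_rmap _)) // addrACA.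
    + by rewrite !(tmapE (can_hom_rmap _)) // can_homD tens_eltDl.
  have phir := rhom_eval_rmap phi.
  have [tr tE] := cendP (t y).
  transitivity (tmap (M := S) (M' := N) phi id (coact (t y x))); last first.
    rewrite tE tmap_comp //; congr (tmap _ _ _); apply/funext => x0.
    by rewrite can_hom_can.
  rewrite can_eltE.
  transitivity (tmap (M := S) (M' := N) phi id
    ((id ⊗m h) ((id ⊗m (@cop _ _ C)) (coact (b := S) y)))).
    by rewrite !tmap_comp.
  congr (tmap _ _ _).
  have tyE : t y x = can_hom (N := res_bimod S) (coact (b := S) y) x.
    by rewrite -can_elt_id can_hom_can.
  rewrite tyE -(coact_coassoc (bicomP S)).
  move: (coact (b := S) y); apply: tens_ext => [z z'|z z'|y0 c1].
  - by rewrite tmapD // tassocD tmapD.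
  - by rewrite can_homD (rmapD cr).
  rewrite tmapE // can_homE [RHS](rmapr cr).
  move: (coact y0); apply: tens_ext => [z z'|z z'|y1 c2].
  - by rewrite tens_eltDl tassocD tmapD.
  - exact: tens_rD.
  - by rewrite tassocE tmapE // hE [RHS]tens_rE.
have mB := reg_act_bal.
have := congr1 (tlift (fun (a : A) (c : C) => a *^l c)) (key R (((1 : A) : R) ⊗e c)).
rewrite !tmapE // (tliftE mB) lact1 -/(h _) => {1}->.
have hr := can_hom_rmap (((1 : A) : R) ⊗e c).
have qB : balanced (@ract _ _ _ S) (@lact _ _ _ C)
    (fun x0 x1 => qt_of_hom c x0 *^l x1).
  have [fD fr] := rhomP (qt_of_hom c).
  by split=> *; rewrite ?fD ?lactDl ?lactDr // fr lactA.
move: (coact x); apply: tens_ext => [z z'|z z'|x0 x1].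
- by rewrite (tmapD hr) // (tliftD mB).
- exact: tliftD qB _ _.
- by rewrite (tmapE hr) // (tliftE mB) (tliftE qB).
Qed.

Definition qtilde_of_end : Qtilde E S := QTilde qt_of_bimap qt_of_cop.

(** The coaction of y is can (id ⊗ y), so can_hom sends it to t y. *)
Lemma qt_end_of y : qt_end qtilde_of_end y = t y.
Proof.
apply: cend_inj => x; rewrite -[RHS]/(id_rhom (t y x)) -can_hom_can can_elt_id.
rewrite -[LHS]/(qt_eval qtilde_of_end (coact y) x).
move: (coact y); apply: tens_ext => [z z'|z z'|y0 c].
- exact: qt_evalD.
- exact: (can_homD (N := res_bimod S)).
- by rewrite qt_evalE can_homE.
Qed.
End Galois.

(** * Normal bases *)

Section NormalBasis.
Variables (k : comPzRingType) (A L : kalg k) (C : coring A) (D : coring L).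
Variables (E : right_ext C D) (pureE : pure_ext E) (S : bicom L C).

Let TD_map (t : S -> cend_bimod S) : ind_TD S pureE -> free_TD D S :=
  cofree_map (M := ind_TD S pureE) t.

Lemma ind_LD_lmap (j : reg_bicom D -> ind_LD S pureE) :
  is_comap j -> is_lmap (M := D) (N := S) j.
Proof. by move=> [[jD jl] _]; split. Qed.

(** By T-linearity it suffices to treat 1 ⊗ d, which goes to
    t_q (j d_(1)) ⊗ d_(2) = eps(d_(1)) ⊗ d_(2) = 1 ⊗ d. *)
Lemma lozenge_cofreeK (j : reg_bicom D -> ind_LD S pureE) (q : Qtilde E S) :
  is_comap j -> (forall d, pq_lozenge (S := S) j q d = cend_in S (cou d)) ->
  cancel (free_map (S := S) j) (TD_map (qt_end q)).
Proof.
move=> jC jq; have jL := ind_LD_lmap jC; have [_ [jr jE]] := jC.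
have tB := qt_end_bimap q.
have [cl [cr _]] : is_comap (TD_map (qt_end q)) by apply: cofree_comap.
apply: tens_ext => [x y|//|f d]; first by rewrite free_mapD // (rmapD cr).
rewrite free_mapE //.
apply: etrans (lmapl cl (f : cend_alg S) (j d)) _.
have -> : TD_map (qt_end q) (j d) = ((1 : cend_alg S) : cend_bimod S) ⊗e d.
  rewrite /TD_map /cofree_map [coact _]ind_coact_eval [ind_coact _ _]jE.
  rewrite -[coact (b := reg_bicom D) d]/(cop d) -[in RHS](cop_coul (corP D) d).
  have lb := counit_lact_bal D.
  move: (cop d); apply: tens_ext => [x y|x y|d1 d2].
  - by rewrite (tmapD jr) // (tmapD (proj2 tB)).
  - by rewrite (tliftD lb) tens_eltDr.
  rewrite (tmapE jr) // (tmapE (proj2 tB)) // (tliftE lb) -tens_eltA.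
  congr (_ ⊗e _); rewrite -[LHS]/(pq_lozenge (S := S) j q d1) jq.
  by rewrite -[RHS]/(1 * cend_in S _) mul1r.
rewrite [LHS]tens_lE; congr (_ ⊗e _).
by rewrite -[LHS]/(f * 1) mulr1.
Qed.

(** Apply T ⊗ eps to the image of 1 ⊗ d. *)
Lemma cofreeK_lozenge (j : reg_bicom D -> ind_LD S pureE) (q : Qtilde E S) d :
  is_comap j -> cancel (free_map (S := S) j) (TD_map (qt_end q)) ->
  pq_lozenge (S := S) j q d = cend_in S (cou d).
Proof.
move=> jC fK; have jL := ind_LD_lmap jC; have [_ tr] := qt_end_bimap q.
pose u : cend_bimod S := (1 : cend_alg S).
transitivity (ru (u ⊗e d : cend_bimod S ⊗ D)); last first.
  by rewrite ruE -[LHS]/(1 * cend_in S _) mul1r.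
rewrite -(fK (u ⊗e d)) free_mapE //.
rewrite [RHS](ru_nat (M := ind_bimod E (eval_bicom S)) (N := cend_bimod S)) //.
congr (qt_end q); symmetry.
exact: (coact_cou (bicomP (ind_TD S pureE)) (j d)).
Qed.

(** The universal properties of T ⊗ D give j and t, and the Galois property
    turns t into an element of Qtilde. *)
Lemma galois_retract (i : ind_TD S pureE -> free_TD D S)
    (p : free_TD D S -> ind_TD S pureE) :
  galois_comodule S -> is_comap i -> is_comap p -> cancel i p ->
  exists (j : reg_bicom D -> ind_LD S pureE) (q : Qtilde E S),
    [/\ is_comap j, qp_bullet q j =1 id, p =1 free_map (S := S) j &
        i =1 TD_map (qt_end q)].
Proof.
move=> G iC pC iK; have [tB iE] := comap_cofree iC; have [jC pE] := comap_free pC.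
have qE : qt_end (qtilde_of_end G tB) = fun m => ru (i m).
  by apply/funext => y; apply: qt_end_of.
exists (unit_map p), (qtilde_of_end G tB); split=> //; last by rewrite qE.
apply/(qp_bullet_idP pureE) => //; first exact: ind_LD_lmap.
split=> // y; rewrite qE -[RHS]iK (iE y).
by symmetry; apply: pE.
Qed.
End NormalBasis.

Theorem corollary5p3 (k : comPzRingType) (A L : kalg k)
    (C : coring A) (D : coring L) (E : right_ext C D) (pureE : pure_ext E)
    (Sigma : bicom L C) :
  (weak_cleft Sigma pureE <->
     galois_comodule Sigma /\ weak_normal_basis Sigma pureE) /\
  (cleft Sigma pureE <->
     galois_comodule Sigma /\ normal_basis Sigma pureE).
Proof.
split; split.
- move=> [j [q [jC qj]]]; have jL := ind_LD_lmap jC.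
  have [G fK] := proj1 (qp_bullet_idP pureE q jL) qj.
  have iC : is_comap (cofree_map (M := ind_TD Sigma pureE)
    (X := cend_bimod Sigma) (qt_end q)).
    exact/cofree_comap/qt_end_bimap.
  by split=> //; apply: (retract_iso_direct_summand iC (free_comap jC) fK).
- move=> [G [Z [i [p [_ [_ [[iC pC] _ [iK _] _ _]]]]]]].
  by have [j [q [jC qj _ _]]] := galois_retract G iC pC iK; exists j, q.
- move=> [j [q [jC qj jq]]]; have jL := ind_LD_lmap jC.
  have [G fK] := proj1 (qp_bullet_idP pureE q jL) qj.
  split=> //; exists (cofree_map (M := ind_TD Sigma pureE)
    (X := cend_bimod Sigma) (qt_end q)), (free_map (S := Sigma) j).
  split=> //; first exact/cofree_comap/qt_end_bimap.
    exact: free_comap.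
  exact: lozenge_cofreeK.
- move=> [G [i [p [iC pC iK pK]]]].
  have [j [q [jC qj pE iE]]] := galois_retract G iC pC iK.
  exists j, q; split=> // d.
  by apply: (cofreeK_lozenge (pureE := pureE)) => // z; rewrite -pE -[LHS]iE.
Qed.
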